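(* Consider the family of vector fields on $\mathbb R^2_{\theta,\tau}$ $$\dot\theta=\cos\theta+\ell\omega+(1+u\omega)\cos\tau,\qquad\dot\tau=\omega,$$ and put $c_\pm=u\pm\ell$. Let $I_0=[0,\pi]\times\{-\frac{2\pi}3\}$ and $I_1=[0,\pi]\times\{\frac\pi3\}$. For every $m,k\in\mathbb Z_{\ge0}$ and $\varepsilon\in(0,1)$, for every $\omega>0$ small enough depending on $m,k,\varepsilon$, and for every $(\ell,u)\in\mathbb R^2$ such that $c_+\in Z_{m,\varepsilon}$ and $c_-\in Z_{k,\varepsilon}$: 1) the forward orbit $\mathcal O(I_0)$ enters $\mathrm{Int}(I_1')$, where $I_1'=I_1+(2\pi m,0)$; 2) the forward orbit $\mathcal O(I_1')$ enters $\mathrm{Int}(I_0')$, where $I_0'=I_0+(2\pi(m-k),2\pi)$.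
   Context: For $m\in\mathbb Z_{\ge0}$ and $\varepsilon\in(0,1)$: $Z_{m,\varepsilon}=[2m-1+\varepsilon,2m+1-\varepsilon]$ if $m\ge1$, and $Z_{0,\varepsilon}=[-\frac1\varepsilon,1-\varepsilon]$. $\mathcal O(I)$ denotes the forward orbit of a set $I\subset\mathbb R^2$ under the flow of the vector field. For horizontal segments $I\subset\{\tau=\tau_1\}$ and $J\subset\{\tau=\tau_2\}$, $\tau_1<\tau_2$, ''$\mathcal O(I)$ enters $\mathrm{Int}(J)$'' means that the time $\frac{\tau_2-\tau_1}\omega$ flow map $\{\tau=\tau_1\}\to\{\tau=\tau_2\}$ sends $I$ into the interior (in the horizontal line) of $J$. *)

(* Defs.v *)
From Stdlib Require Import Reals ClassicalEpsilon.
From Coquelicot Require Import Coquelicot.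

Open Scope R_scope.

(** A point of the plane is the pair [(theta, tau)]. *)
Definition vector_field (omega l u : R) (p : R * R) : R * R :=
  (cos (fst p) + l * omega + (1 + u * omega) * cos (snd p), omega).

Definition integral_curve (V : R * R -> R * R) (gamma : R -> R * R) : Prop :=
  forall t : R, is_derive gamma t (V (gamma t)).

(** [epsilon] selects an integral curve through [p]; for a globally Lipschitz
    field, such as [vector_field omega l u], it exists and is unique. For a
    field without such a curve the value is arbitrary. *)
Definition flow (V : R * R -> R * R) (t : R) (p : R * R) : R * R :=
  epsilon (inhabits (fun _ : R => p))
    (fun gamma => gamma 0 = p /\ integral_curve V gamma) t.

Record hsegment : Type :=
  HSegment { seg_left : R; seg_right : R; seg_height : R }.

Definition seg_set (I : hsegment) (p : R * R) : Prop :=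
  seg_left I <= fst p <= seg_right I /\ snd p = seg_height I.

Definition translate (I : hsegment) (v : R * R) : hsegment :=
  HSegment (seg_left I + fst v) (seg_right I + fst v) (seg_height I + snd v).

(** Interior relative to the horizontal line through the point, not in the
    plane (where it would be empty). *)
Definition hinterior (J : hsegment) (p : R * R) : Prop :=
  locally (fst p) (fun theta : R => seg_set J (theta, snd p)).

Definition orbit_enters_interior (omega l u : R) (I J : hsegment) : Prop :=
  forall p : R * R, seg_set I p ->
    hinterior J (flow (vector_field omega l u)
                   ((seg_height J - seg_height I) / omega) p).

Definition Z_interval (m : nat) (eps x : R) : Prop :=
  match m with
  | O => - (1 / eps) <= x <= 1 - eps
  | S _ => 2 * INR m - 1 + eps <= x <= 2 * INR m + 1 - eps
  end.

Definition I0 : hsegment := HSegment 0 PI (- (2 * PI / 3)).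
Definition I1 : hsegment := HSegment 0 PI (PI / 3).
Definition I1' (m : nat) : hsegment := translate I1 (2 * PI * INR m, 0).
Definition I0' (m k : nat) : hsegment :=
  translate I0 (2 * PI * (INR m - INR k), 2 * PI).

(* Main.v *)
Require Import Defs.
From Stdlib Require Import Reals Lra Lia Factorial Ranalysis5 ClassicalEpsilon.
From Coquelicot Require Import Coquelicot.
Open Scope R_scope.

(** Put [phi = theta - PI], as a function of [tau]. In [v = 2 cos(tau/2) tan(phi/2)]
    and [sigma = 2 sin(tau/2)] the equation becomes
    [omega v' = (v^2 - sigma^2)/2 + omega (u + l) + ...], so near [tau = 0], on the
    scale [sqrt omega], it is the Riccati form of Weber's equation. When
    [u + l = 2n+1] the model has the explicit solution [Y - 2 He_n'/He_n]; its
    angle makes exactly [n] turns, because [He_n] has [n] real zeros. Multiplying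
    it by a constant [rho > 1] (resp. [rho < 1]) gives a sub- (resp. super-)
    solution of the full equation, valid up to both ends of the segment, as soon
    as [u + l > 2n+1] (resp. [u + l < 2n+1]) and [omega] is small. Hence for
    [2m-1 < u + l < 2m+1] the phase makes at least [m - 1] turns and ends above
    the unstable branch, and at most [m] turns and ends below it, so that it is
    attracted by the stable branch after [m] turns. The second half of the period
    is the first one with [l] replaced by [- l]. *)

(** * Existence of integral curves *)

(** The branches [phi = tau] and [phi = - tau] of the slow curve [cos phi = cos tau] cross at the
    origin. Away from the crossing the phase moves at speed of order [1 / omega] and straight lines
    serve as barriers. At the crossing they fail: the phase arrives along the attracting half of
    [phi = tau], and terms of order [omega] in [omega * phi'] decide on which side of the repelling
    half it leaves. The factor [rho] separates these two scales. The defect of the scaled model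
    solution has a part of order one with the sign of [rho - 1], vanishing only where
    [sin (tau / 2)] and the numerator of [v] both vanish; there the part of order [omega] has the
    sign of [u + l - rho (2n+1)]. So [rho] is taken between [1] and [(u + l) / (2n+1)], and [n] and
    [eps] alone determine it. A [rho] different from [1] also moves the barrier off the slow curve
    by a fixed angle, which is the room that the straight barriers need at both ends. The model
    solution has poles at the zeros of [He_n]; they disappear when the angle of a plane vector is
    followed instead of its tangent. *)

Lemma derive_nonneg_le (f df : R -> R) (a b : R) :
  a <= b ->
  (forall t, a <= t <= b -> is_derive f t (df t)) ->
  (forall t, a <= t <= b -> 0 <= df t) -> f a <= f b.
Proof.
  intros Hab Hd Hpos.
  destruct (MVT_gen f a b df) as [c [Hc Heq]];
    rewrite ?Rmin_left, ?Rmax_right in * by lra.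
  - intros x Hx. apply Hd. lra.
  - intros x Hx. apply derivable_continuous_pt. exists (df x).
    apply is_derive_Reals, Hd, Hx.
  - assert (0 <= df c * (b - a)) by (apply Rmult_le_pos; [apply Hpos|]; lra).
    lra.
Qed.

Lemma derive_zero_eq (f : R -> R) (a b : R) :
  (forall t, Rmin a b <= t <= Rmax a b -> is_derive f t 0) -> f a = f b.
Proof.
  intros Hd.
  destruct (MVT_gen f a b (fun _ => 0)) as [c [_ Heq]].
  - intros x Hx. apply Hd. lra.
  - intros x Hx. apply derivable_continuous_pt. exists 0.
    apply is_derive_Reals, Hd, Hx.
  - lra.
Qed.

Lemma cos_lipschitz (x y : R) : Rabs (cos x - cos y) <= Rabs (x - y).
Proof.
  destruct (MVT_gen cos y x (fun t => - sin t)) as [c [_ Heq]].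
  - intros t _. apply is_derive_Reals, derivable_pt_lim_cos.
  - intros t _. apply continuity_cos.
  - rewrite Heq, Rabs_mult.
    rewrite <- (Rmult_1_l (Rabs (x - y))) at 2.
    apply Rmult_le_compat_r; [apply Rabs_pos|].
    apply Rabs_le. destruct (SIN_bound c). lra.
Qed.

Fixpoint picard (g : R -> R) (x0 : R) (n : nat) (t : R) : R :=
  match n with
  | O => x0
  | S p => x0 + RInt (fun s => cos (picard g x0 p s) + g s) 0 t
  end.

Lemma picard_derive_succ (g : R -> R) (x0 : R) (n : nat) :
  (forall t, continuous g t) ->
  (forall t, continuous (picard g x0 n) t) ->
  forall t, is_derive (picard g x0 (S n)) t (cos (picard g x0 n t) + g t).
Proof.
  intros Hg Hc t.
  assert (Hint : forall s, continuous (fun s => cos (picard g x0 n s) + g s) s).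
  { intros s. apply (continuous_plus (fun s => cos (picard g x0 n s)) g).
    - apply continuous_comp; [apply Hc|apply continuous_cos].
    - apply Hg. }
  simpl.
  evar_last.
  { apply (is_derive_plus (fun _ => x0)).
    - apply is_derive_const.
    - apply (is_derive_RInt (fun s => cos (picard g x0 n s) + g s) _ 0).
      + apply filter_forall. intros y. apply (RInt_correct (V := R_CompleteNormedModule)).
        apply (ex_RInt_continuous (V := R_CompleteNormedModule)).
        intros z _. apply Hint.
      + apply Hint. }
  unfold plus, zero; simpl. ring.
Qed.

Lemma picard_continuous (g : R -> R) (x0 : R) (n : nat) :
  (forall t, continuous g t) -> forall t, continuous (picard g x0 n) t.
Proof.
  intros Hg. induction n as [|n IH]; intros t.
  - apply continuous_const.
  - apply (ex_derive_continuous (V := R_NormedModule)).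
    eexists. now apply picard_derive_succ.
Qed.

Lemma picard_derive (g : R -> R) (x0 : R) (n : nat) (t : R) :
  (forall t, continuous g t) ->
  is_derive (picard g x0 (S n)) t (cos (picard g x0 n t) + g t).
Proof.
  intros Hg. apply picard_derive_succ; [|intros s; apply picard_continuous];
    assumption.
Qed.

Lemma picard_0 (g : R -> R) (x0 : R) (n : nat) : picard g x0 n 0 = x0.
Proof.
  destruct n; simpl; [reflexivity|]. rewrite RInt_point. unfold zero; simpl. ring.
Qed.

Lemma is_derive_pow_fact (K : R) (n : nat) (t : R) :
  is_derive (fun t => K * t ^ S n / INR (fact (S n))) t
    (K * t ^ n / INR (fact n)).
Proof.
  assert (H := INR_fact_neq_0 n).
  assert (Hn : INR (S n) <> 0) by (apply not_0_INR; lia).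
  auto_derive; [trivial|].
  change (Init.Nat.pred (S n)) with n.
  change (fact n + n * fact n)%nat with (S n * fact n)%nat.
  rewrite mult_INR. change (match n with O => 1 | S _ => INR n + 1 end) with (INR (S n)).
  field. split; assumption.
Qed.

Lemma pow_fact_bound_pos (f df : R -> R) (K : R) (n : nat) :
  f 0 = 0 -> (forall t, is_derive f t (df t)) ->
  (forall t, 0 <= t -> Rabs (df t) <= K * t ^ n / INR (fact n)) ->
  forall t, 0 <= t -> Rabs (f t) <= K * t ^ S n / INR (fact (S n)).
Proof.
  intros H0 Hd Hb t Ht.
  pose (P := fun t => K * t ^ S n / INR (fact (S n))).
  assert (HP0 : P 0 = 0).
  { unfold P, Rdiv. rewrite pow_i by lia. ring. }
  change (Rabs (f t) <= P t).
  assert (H1 : P 0 - f 0 <= P t - f t).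
  { apply (derive_nonneg_le (fun t => P t - f t)
             (fun t => K * t ^ n / INR (fact n) - df t)); [lra| |].
    - intros s _. apply (is_derive_minus P f); [apply is_derive_pow_fact|apply Hd].
    - intros s Hs. generalize (Rle_abs (df s)) (Hb s (proj1 Hs)). lra. }
  assert (H2 : P 0 + f 0 <= P t + f t).
  { apply (derive_nonneg_le (fun t => P t + f t)
             (fun t => K * t ^ n / INR (fact n) + df t)); [lra| |].
    - intros s _. apply (is_derive_plus P f); [apply is_derive_pow_fact|apply Hd].
    - intros s Hs. generalize (Rle_abs (- df s)) (Hb s (proj1 Hs)).
      rewrite Rabs_Ropp. lra. }
  apply Rabs_le. lra.
Qed.

Lemma pow_fact_bound (f df : R -> R) (K : R) (n : nat) :
  f 0 = 0 -> (forall t, is_derive f t (df t)) ->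
  (forall t, Rabs (df t) <= K * Rabs t ^ n / INR (fact n)) ->
  forall t, Rabs (f t) <= K * Rabs t ^ S n / INR (fact (S n)).
Proof.
  intros H0 Hd Hb t.
  destruct (Rle_dec 0 t) as [Ht|Ht].
  - rewrite (Rabs_pos_eq t) by assumption.
    apply (pow_fact_bound_pos f df); auto.
    intros s Hs. generalize (Hb s). now rewrite (Rabs_pos_eq s).
  - rewrite (Rabs_left t) by lra.
    rewrite <- (Ropp_involutive t) at 1.
    apply (pow_fact_bound_pos (fun s => f (- s)) (fun s => - df (- s))).
    + now rewrite Ropp_0.
    + intros s. evar_last.
      * apply (is_derive_comp f); [apply Hd|].
        instantiate (1 := - 1). auto_derive; [trivial|ring].
      * unfold scal; simpl. unfold mult; simpl. ring.
    + intros s Hs. generalize (Hb (- s)).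
      now rewrite !Rabs_Ropp, (Rabs_pos_eq s).
    + lra.
Qed.

(** The first increment has derivative [cos x0 + g], bounded by [1 + C]. Each later one has
    derivative bounded by the previous increment, the cosine being 1-Lipschitz, so every step
    integrates the monomial bound once more. *)
Lemma picard_step_bound (g : R -> R) (x0 C : R) (n : nat) (t : R) :
  (forall t, continuous g t) -> (forall t, Rabs (g t) <= C) ->
  Rabs (picard g x0 (S n) t - picard g x0 n t)
    <= (1 + C) * Rabs t ^ S n / INR (fact (S n)).
Proof.
  intros Hg Hb. revert t. induction n as [|n IH]; intros t.
  - apply (pow_fact_bound (fun t => picard g x0 1 t - x0)
             (fun t => cos x0 + g t)).
    + rewrite picard_0. ring.
    + intros s. evar_last.
      * apply (is_derive_minus (picard g x0 1) (fun _ => x0)).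
        -- apply picard_derive, Hg.
        -- apply is_derive_const.
      * unfold minus, plus, opp, zero; simpl. ring.
    + intros s. simpl. replace ((1 + C) * 1 / 1) with (1 + C) by field.
      eapply Rle_trans; [apply Rabs_triang|].
      apply Rplus_le_compat; [|apply Hb].
      apply Rabs_le. destruct (COS_bound x0). lra.
  - apply (pow_fact_bound (fun t => picard g x0 (S (S n)) t - picard g x0 (S n) t)
             (fun t => cos (picard g x0 (S n) t) - cos (picard g x0 n t))).
    + rewrite !picard_0. ring.
    + intros s. evar_last.
      * apply (is_derive_minus (picard g x0 (S (S n))) (picard g x0 (S n)));
          apply picard_derive, Hg.
      * unfold minus, plus, opp; simpl. ring.
    + intros s. eapply Rle_trans; [apply cos_lipschitz|apply IH].
Qed.

Lemma ex_series_pow_fact (K T : R) :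
  ex_series (fun n => K * T ^ S n / INR (fact (S n))).
Proof.
  apply (ex_series_incr_1 (fun n => K * T ^ n / INR (fact n))).
  apply (ex_series_ext (fun n => scal K (/ INR (fact n) * T ^ n))).
  - intros n. unfold scal; simpl. unfold mult; simpl. unfold Rdiv. ring.
  - apply (ex_series_scal (V := R_NormedModule) K). exists (exp T).
    generalize (is_exp_Reals T). unfold is_pseries.
    apply is_series_ext. intros n. unfold scal; simpl. unfold mult; simpl.
    rewrite pow_n_pow. ring.
Qed.

Lemma picard_diff_bound (g : R -> R) (x0 C T : R) (n p : nat) (t : R) :
  (forall t, continuous g t) -> (forall t, Rabs (g t) <= C) -> Rabs t <= T ->
  Rabs (picard g x0 (n + S p) t - picard g x0 n t)
    <= sum_n_m (fun j => (1 + C) * T ^ S j / INR (fact (S j))) n (n + p).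
Proof.
  intros Hg Hb Ht.
  assert (HC : 0 <= C) by (eapply Rle_trans; [apply Rabs_pos|apply (Hb 0)]).
  assert (Hstep : forall j, Rabs (picard g x0 (S j) t - picard g x0 j t)
                   <= (1 + C) * T ^ S j / INR (fact (S j))).
  { intros j. eapply Rle_trans; [now apply (picard_step_bound g x0 C)|].
    unfold Rdiv. apply Rmult_le_compat_r.
    - left. apply Rinv_0_lt_compat, INR_fact_lt_0.
    - apply Rmult_le_compat_l; [lra|]. apply pow_incr. split; [apply Rabs_pos|lra]. }
  induction p as [|p IH].
  - rewrite Nat.add_0_r, sum_n_n. replace (n + 1)%nat with (S n) by lia.
    apply Hstep.
  - replace (n + S (S p))%nat with (S (n + S p)) by lia.
    replace (n + S p)%nat with (S (n + p)) in * by lia.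
    rewrite sum_n_Sm by lia. unfold plus; simpl plus.
    replace (picard g x0 (S (S (n + p))) t - picard g x0 n t) with
      ((picard g x0 (S (n + p)) t - picard g x0 n t)
       + (picard g x0 (S (S (n + p))) t - picard g x0 (S (n + p)) t)) by ring.
    eapply Rle_trans; [apply Rabs_triang|]. apply Rplus_le_compat; [exact IH|apply Hstep].
Qed.

Lemma picard_cauchy (g : R -> R) (x0 C T : R) :
  (forall t, continuous g t) -> (forall t, Rabs (g t) <= C) ->
  CVU_cauchy (picard g x0) (fun t => - T < t < T).
Proof.
  intros Hg Hb eps.
  destruct (Cauchy_ex_series _ (ex_series_pow_fact (1 + C) T) eps) as [N HN].
  assert (Hle : forall n m t, - T < t < T -> (N <= n)%nat -> (n < m)%nat ->
            Rabs (picard g x0 m t - picard g x0 n t) < eps).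
  { intros n m t Ht Hn Hnm.
    replace m with (n + S (m - n - 1))%nat by lia.
    eapply Rle_lt_trans.
    - apply (picard_diff_bound g x0 C T); auto. apply Rabs_le. lra.
    - eapply Rle_lt_trans; [apply Rle_abs|]. apply HN; lia. }
  exists N. intros n m t Ht Hn Hm.
  destruct (Nat.lt_total n m) as [H|[H|H]].
  - rewrite Rabs_minus_sym. now apply Hle.
  - subst. rewrite Rminus_diag, Rabs_R0. apply cond_pos.
  - now apply Hle.
Qed.

Lemma cos_ode_exists (g : R -> R) (x0 C : R) :
  (forall t, continuous g t) -> (forall t, Rabs (g t) <= C) ->
  exists x : R -> R, x 0 = x0 /\ forall t, is_derive x t (cos (x t) + g t).
Proof.
  intros Hg Hb.
  (* The sequence starts at the first iterate because the derivative formula [picard_derive] holds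
     only from there on; the limit is the same. *)
  pose (x := fun t => real (Lim_seq (fun n => picard g x0 (S n) t))).
  assert (HD : forall n t, Derive (picard g x0 (S n)) t = cos (picard g x0 n t) + g t)
    by (intros; apply is_derive_unique, picard_derive, Hg).
  exists x. split.
  { unfold x. rewrite (Lim_seq_ext _ (fun _ => x0)) by (intros; apply picard_0).
    now rewrite Lim_seq_const. }
  intros t. pose (T := Rabs t + 1).
  assert (Ht : - T < t < T).
  { unfold T. generalize (Rle_abs t) (Rle_abs (- t)). rewrite Rabs_Ropp. lra. }
  assert (Hcau := picard_cauchy g x0 C T Hg Hb).
  assert (Hlim : is_lim_seq (fun n => picard g x0 n t) (x t)).
  { unfold x. rewrite (Lim_seq_incr_1 (fun n => picard g x0 n t)).
    apply Lim_seq_correct', ex_lim_seq_cauchy_corr.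
    intros eps. destruct (Hcau eps) as [N HN]. exists N. intros; apply HN; auto. }
  evar_last.
  - apply (CVU_Derive (fun n => picard g x0 (S n)) (fun t => - T < t < T)).
    + apply (open_and (fun t => - T < t) (fun t => t < T));
        [apply open_gt|apply open_lt].
    + intros a b z Ha Hz Hz'. lra.
    + apply CVU_dom_cauchy. intros eps. destruct (Hcau eps) as [N HN].
      exists N. intros; apply HN; auto.
    + intros n s _. eexists. apply picard_derive, Hg.
    + intros n s _. apply continuity_pt_filterlim.
      apply (continuous_ext (fun s => cos (picard g x0 n s) + g s)).
      * intros; symmetry; apply HD.
      * apply (continuous_plus (fun s => cos (picard g x0 n s)) g).
        -- apply continuous_comp; [now apply picard_continuous|apply continuous_cos].
        -- apply Hg.
    + apply CVU_dom_cauchy. intros eps. destruct (Hcau eps) as [N HN].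
      exists N. intros n m s Hs Hn Hm. rewrite !HD.
      eapply Rle_lt_trans; [|apply (HN n m s); assumption].
      replace (cos (picard g x0 n s) + g s - (cos (picard g x0 m s) + g s))
        with (cos (picard g x0 n s) - cos (picard g x0 m s)) by ring.
      apply cos_lipschitz.
    + exact Ht.
  - rewrite (Lim_seq_ext _ (fun n => cos (picard g x0 n t) + g t)) by (intros; apply HD).
    rewrite (is_lim_seq_unique _ (cos (x t) + g t)); [reflexivity|].
    apply (is_lim_seq_plus' (fun n => cos (picard g x0 n t)) (fun _ => g t)).
    + apply (is_lim_seq_continuous cos); [apply continuity_cos|exact Hlim].
    + apply is_lim_seq_const.
Qed.

Lemma is_derive_pair (x y : R -> R) (t dx dy : R) :
  is_derive x t dx -> is_derive y t dy ->
  is_derive (fun s => (x s, y s)) t (dx, dy).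
Proof.
  intros Hx Hy. unfold is_derive.
  apply (filterdiff_comp'_2 x y (fun a b => (a, b)) t
           (fun s => scal s dx) (fun s => scal s dy) (fun a b => (a, b)));
    [exact Hx|exact Hy|].
  apply (filterdiff_ext (fun p : R * R => p)); [now intros [a b]|].
  apply (filterdiff_ext_lin _ (fun p : R * R => p)); [|now intros [a b]].
  apply filterdiff_id.
Qed.

Lemma is_derive_components (g : R -> R * R) (t : R) (v : R * R) :
  is_derive g t v ->
  is_derive (fun s => fst (g s)) t (fst v) /\
  is_derive (fun s => snd (g s)) t (snd v).
Proof.
  intros H. split.
  - apply (filterdiff_comp' g fst t (fun s => scal s v) fst H).
    apply filterdiff_linear, is_linear_fst.
  - apply (filterdiff_comp' g snd t (fun s => scal s v) snd H).
    apply filterdiff_linear, is_linear_snd.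
Qed.

Lemma integral_curve_exists (omega l u : R) (p : R * R) :
  exists gamma : R -> R * R,
    gamma 0 = p /\ integral_curve (vector_field omega l u) gamma.
Proof.
  destruct p as [x0 tau0].
  pose (g := fun t => l * omega + (1 + u * omega) * cos (tau0 + omega * t)).
  destruct (cos_ode_exists g x0 (Rabs (l * omega) + Rabs (1 + u * omega)))
    as [x [Hx0 Hx]].
  - intros t. apply (ex_derive_continuous (V := R_NormedModule)).
    unfold g. auto_derive. trivial.
  - intros t. unfold g. eapply Rle_trans; [apply Rabs_triang|].
    apply Rplus_le_compat_l. rewrite Rabs_mult.
    rewrite <- (Rmult_1_r (Rabs (1 + u * omega))) at 2.
    apply Rmult_le_compat_l; [apply Rabs_pos|].
    apply Rabs_le, COS_bound.
  - exists (fun t => (x t, tau0 + omega * t)). split.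
    + rewrite Hx0. f_equal. ring.
    + intros t. unfold vector_field. simpl fst. simpl snd.
      apply is_derive_pair.
      * evar_last; [apply Hx|]. unfold g. ring.
      * auto_derive; [trivial|ring].
Qed.

(** As [flow] is a choice by [epsilon], the existence of an integral curve is what gives access to
    its properties. The second component has constant derivative, which leaves a scalar equation
    with explicit time dependence. *)
Lemma flow_spec (omega l u : R) (p : R * R) :
  exists x : R -> R,
    x 0 = fst p /\
    (forall t, is_derive x t
       (cos (x t) + l * omega + (1 + u * omega) * cos (snd p + omega * t))) /\
    forall t, flow (vector_field omega l u) t p = (x t, snd p + omega * t).
Proof.
  assert (H := epsilon_spec (inhabits (fun _ : R => p)) _
                 (integral_curve_exists omega l u p)).
  unfold flow. set (gamma := epsilon _ _) in *.
  destruct H as [H0 Hc].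
  assert (Hsnd : forall t, snd (gamma t) = snd p + omega * t).
  { intros t.
    assert (E : snd (gamma 0) - omega * 0 = snd (gamma t) - omega * t).
    { apply (derive_zero_eq (fun s => snd (gamma s) - omega * s)). intros s _.
      evar_last.
      - apply (is_derive_minus (fun s => snd (gamma s)) (fun s => omega * s)).
        + exact (proj2 (is_derive_components _ _ _ (Hc s))).
        + instantiate (1 := omega). auto_derive; [trivial|ring].
      - unfold minus, plus, opp; simpl. ring. }
    rewrite H0 in E. lra. }
  exists (fun t => fst (gamma t)). split; [now rewrite H0|split].
  - intros t. rewrite <- Hsnd. exact (proj1 (is_derive_components _ _ _ (Hc t))).
  - intros t. rewrite <- Hsnd. now destruct (gamma t).
Qed.

(** * Barriers for the phase equation *)

Lemma is_derive_continuity_pt (f : R -> R) (t df : R) :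
  is_derive f t df -> continuity_pt f t.
Proof.
  intros H. apply derivable_continuous_pt. exists df. now apply is_derive_Reals.
Qed.

(** The point [s] is the supremum of the times where [d] is nonnegative. After it the sign of [d] is
    fixed, which removes the absolute value from the Lipschitz bound in the comparison below. *)
Lemma last_nonneg (d : R -> R) (a b : R) :
  a <= b -> (forall t, a <= t <= b -> continuity_pt d t) ->
  0 <= d a -> d b < 0 ->
  exists s, a <= s < b /\ d s = 0 /\ forall t, s < t <= b -> d t < 0.
Proof.
  intros Hab Hc Ha Hb.
  pose (E := fun t => a <= t <= b /\ 0 <= d t).
  destruct (completeness E) as [s [Hub Hlub]].
  - exists b. intros t [Ht _]. lra.
  - exists a. split; [lra|exact Ha].
  - assert (Has : a <= s) by (apply Hub; split; [lra|exact Ha]).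
    assert (Hsb : s <= b) by (apply Hlub; intros t [Ht _]; lra).
    assert (Hs : 0 <= d s).
    { destruct (Rle_dec 0 (d s)) as [|Hn]; [assumption|exfalso].
      destruct (Hc s (conj Has Hsb) (- d s)) as [del [Hdel Hnear]]; [lra|].
      assert (s <= s - del / 2); [|lra].
      apply Hlub. intros t [Ht Hdt].
      destruct (Rle_dec t (s - del / 2)) as [|Htn]; [assumption|exfalso].
      assert (t <= s) by (apply Hub; now split).
      destruct (Req_dec t s) as [->|Hne]; [lra|].
      assert (Hd : Rabs (d t - d s) < - d s).
      { apply Hnear. split.
        - split; [exact I|auto].
        - simpl. unfold R_dist. apply Rabs_def1; lra. }
      apply Rabs_def2 in Hd. lra. }
    assert (Hlt : s < b) by (destruct Hsb as [|Heq]; [assumption|subst; lra]).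
    assert (Hneg : forall t, s < t <= b -> d t < 0).
    { intros t Ht. destruct (Rlt_dec (d t) 0) as [|Hn]; [assumption|exfalso].
      assert (t <= s); [|lra]. apply Hub. split; lra. }
    exists s. split; [lra|split; [|exact Hneg]].
    destruct Hs as [Hs|Hs]; [exfalso|now symmetry].
    destruct (Hc s (conj Has Hsb) (d s) Hs) as [del [Hdel Hnear]].
    pose (t := s + Rmin (del / 2) (b - s)).
    assert (Hm : 0 < Rmin (del / 2) (b - s)) by (apply Rmin_pos; lra).
    assert (Hm1 := Rmin_l (del / 2) (b - s)).
    assert (Hm2 := Rmin_r (del / 2) (b - s)).
    assert (Hdt : d t < 0) by (apply Hneg; unfold t; lra).
    assert (Hdd : Rabs (d t - d s) < d s).
    { apply Hnear. split.
      - split; [exact I|unfold t; lra].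
      - simpl. unfold R_dist, t. apply Rabs_def1; lra. }
    apply Rabs_def2 in Hdd. lra.
Qed.

(** A Gronwall argument by contradiction. With [d = phi - L] and [s] the last time where [d]
    vanishes, [d' >= - k |d| = k d] after [s], so [d * exp (- k t)] is nondecreasing there; it
    cannot pass from zero to a negative value. *)
Lemma ode_comparison (f : R -> R -> R) (k : R) (phi dphi L dL : R -> R) (a b : R) :
  (forall t x y, Rabs (f t x - f t y) <= k * Rabs (x - y)) ->
  a <= b ->
  (forall t, a <= t <= b -> is_derive phi t (dphi t)) ->
  (forall t, a <= t <= b -> is_derive L t (dL t)) ->
  (forall t, a <= t <= b -> f t (phi t) <= dphi t) ->
  (forall t, a <= t <= b -> dL t <= f t (L t)) ->
  L a <= phi a -> L b <= phi b.
Proof.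
  intros Hlip Hab Hphi HL Hsup Hsub Ha.
  destruct (Rle_dec (L b) (phi b)) as [|Hn]; [assumption|exfalso].
  pose (d := fun t => phi t - L t).
  assert (Hd : forall t, a <= t <= b -> is_derive d t (dphi t - dL t)).
  { intros t Ht. apply (is_derive_minus phi L); auto. }
  destruct (last_nonneg d a b Hab) as [s [Hs [Hds Hneg]]].
  - intros t Ht. eapply is_derive_continuity_pt, Hd, Ht.
  - unfold d. lra.
  - unfold d. lra.
  - assert (d s * exp (- k * s) <= d b * exp (- k * b)).
    { apply (derive_nonneg_le (fun t => d t * exp (- k * t))
        (fun t => (dphi t - dL t) * exp (- k * t) + d t * (- k * exp (- k * t)))).
      - lra.
      - intros t Ht. evar_last.
        + apply (is_derive_mult d (fun t => exp (- k * t))).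
          * apply Hd. lra.
          * instantiate (1 := - k * exp (- k * t)). auto_derive; [trivial|ring].
          * intros; apply Rmult_comm.
        + unfold plus, mult; simpl. ring.
      - intros t Ht.
        replace (_ + _) with ((dphi t - dL t - k * d t) * exp (- k * t)) by ring.
        apply Rmult_le_pos; [|left; apply exp_pos].
        assert (H1 := Hsup t ltac:(lra)). assert (H2 := Hsub t ltac:(lra)).
        assert (H3 := Hlip t (phi t) (L t)). apply Rabs_le_between in H3.
        assert (Hdt : d t <= 0).
        { destruct (Req_dec t s) as [->|Hne]; [lra|left; apply Hneg; lra]. }
        change (phi t - L t) with (d t) in H3. rewrite Rabs_left1 in H3 by exact Hdt.
        lra. }
    assert (d b * exp (- k * b) < 0).
    { assert (H1 := Hneg b ltac:(lra)). assert (H2 := exp_pos (- k * b)). nra. }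
    rewrite Hds, Rmult_0_l in H.
    lra.
Qed.

(** The slope of [phi = theta - PI] with respect to [tau], that is, the overdamped Josephson
    junction equation. Where the leading term vanishes, on [phi = tau] and [phi = - tau] modulo
    [2 PI], a branch attracts if [sin phi < 0] and repels if [sin phi > 0]. *)
Definition josephson (omega l u tau x : R) : R :=
  (cos tau - cos x) / omega + l + u * cos tau.

Definition josephson_solution (omega l u : R) (phi : R -> R) : Prop :=
  forall tau, is_derive phi tau (josephson omega l u tau (phi tau)).

Lemma josephson_lipschitz (omega l u tau x y : R) :
  0 < omega ->
  Rabs (josephson omega l u tau x - josephson omega l u tau y)
    <= / omega * Rabs (x - y).
Proof.
  intros Hw. unfold josephson.
  replace (_ - _) with (/ omega * (cos y - cos x)) by (field; lra).
  rewrite Rabs_mult, Rabs_pos_eq by (left; now apply Rinv_0_lt_compat).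
  apply Rmult_le_compat_l; [left; now apply Rinv_0_lt_compat|].
  rewrite (Rabs_minus_sym x y). apply cos_lipschitz.
Qed.

Lemma josephson_subsolution (omega l u : R) (phi L dL : R -> R) (a b : R) :
  0 < omega -> a <= b -> josephson_solution omega l u phi ->
  (forall t, a <= t <= b -> is_derive L t (dL t)) ->
  (forall t, a <= t <= b -> dL t <= josephson omega l u t (L t)) ->
  L a <= phi a -> L b <= phi b.
Proof.
  intros Hw Hab Hphi HL Hsub.
  apply (ode_comparison (josephson omega l u) (/ omega) phi
           (fun t => josephson omega l u t (phi t)) L dL); auto.
  - intros. now apply josephson_lipschitz.
  - intros. apply Rle_refl.
Qed.

Lemma josephson_supersolution (omega l u : R) (phi L dL : R -> R) (a b : R) :
  0 < omega -> a <= b -> josephson_solution omega l u phi ->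
  (forall t, a <= t <= b -> is_derive L t (dL t)) ->
  (forall t, a <= t <= b -> josephson omega l u t (L t) <= dL t) ->
  phi a <= L a -> phi b <= L b.
Proof.
  intros Hw Hab Hphi HL Hsup.
  apply (ode_comparison (josephson omega l u) (/ omega) L dL phi
           (fun t => josephson omega l u t (phi t))); auto.
  - intros. now apply josephson_lipschitz.
  - intros. apply Rle_refl.
Qed.

Lemma drift_bound (M omega mu l u tau : R) :
  0 < omega -> Rabs l <= M -> Rabs u <= M -> omega * (2 * M) <= mu ->
  Rabs (omega * (l + u * cos tau)) <= mu.
Proof.
  intros Hw Hl Hu HM. rewrite Rabs_mult, (Rabs_pos_eq omega) by lra.
  eapply Rle_trans; [|exact HM]. apply Rmult_le_compat_l; [lra|].
  eapply Rle_trans; [apply Rabs_triang|].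
  rewrite Rabs_mult.
  assert (Rabs (cos tau) <= 1) by (apply Rabs_le, COS_bound).
  assert (Rabs u * Rabs (cos tau) <= Rabs u * 1)
    by (apply Rmult_le_compat_l; [apply Rabs_pos|assumption]).
  lra.
Qed.

Lemma is_derive_line (x0 x1 a b t : R) :
  is_derive (fun t => x0 + (x1 - x0) / (b - a) * (t - a)) t ((x1 - x0) / (b - a)).
Proof. auto_derive; [trivial|ring]. Qed.

Lemma line_range (x0 x1 a b t : R) :
  a < b -> a <= t <= b ->
  exists s, 0 <= s <= 1 /\
    x0 + (x1 - x0) / (b - a) * (t - a) = x0 + s * (x1 - x0).
Proof.
  intros Hab Ht. exists ((t - a) / (b - a)). split.
  - split; [apply Rdiv_le_0_compat; lra|].
    apply Rmult_le_reg_r with (b - a); [lra|].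
    unfold Rdiv. rewrite Rmult_assoc, Rinv_l; lra.
  - field. lra.
Qed.

(** On the rectangle the leading term is at least [2 mu / omega] and the drift costs at most
    [mu / omega]. The diagonal of the rectangle is then a subsolution as soon as its slope is at
    most [mu / omega]. *)
Lemma josephson_climb (omega l u M mu : R) (phi : R -> R) (a b x0 x1 : R) :
  0 < omega -> a < b -> x0 <= x1 -> josephson_solution omega l u phi ->
  Rabs l <= M -> Rabs u <= M ->
  (forall t x, a <= t <= b -> x0 <= x <= x1 -> 2 * mu <= cos t - cos x) ->
  omega * (2 * M) <= mu -> omega * (x1 - x0) <= mu * (b - a) ->
  x0 <= phi a -> x1 <= phi b.
Proof.
  intros Hw Hab Hx Hphi Hl Hu Hcos HM Hs Ha.
  replace x1 with (x0 + (x1 - x0) / (b - a) * (b - a)) by (field; lra).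
  apply (josephson_subsolution omega l u phi
    (fun t => x0 + (x1 - x0) / (b - a) * (t - a)) (fun _ => (x1 - x0) / (b - a)) a b);
    auto; [lra| | |lra].
  - intros t _. apply is_derive_line.
  - intros t Ht.
    destruct (line_range x0 x1 a b t Hab Ht) as [s [Hs1 ->]].
    assert (Hc := Hcos t (x0 + s * (x1 - x0)) Ht ltac:(split; nra)).
    assert (Hd := drift_bound M omega mu l u t Hw Hl Hu HM).
    apply Rabs_le_between in Hd. unfold josephson.
    apply Rmult_le_reg_l with omega; [assumption|].
    replace (omega * (_ + l + _)) with
      (cos t - cos (x0 + s * (x1 - x0)) + omega * (l + u * cos t)) by (field; lra).
    apply Rle_trans with mu; [|lra].
    apply Rmult_le_reg_r with (b - a); [lra|].
    replace (omega * _ * _) with (omega * (x1 - x0)) by (field; lra). lra.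
Qed.

Lemma josephson_descend (omega l u M mu : R) (phi : R -> R) (a b x0 x1 : R) :
  0 < omega -> a < b -> x1 <= x0 -> josephson_solution omega l u phi ->
  Rabs l <= M -> Rabs u <= M ->
  (forall t x, a <= t <= b -> x1 <= x <= x0 -> 2 * mu <= cos x - cos t) ->
  omega * (2 * M) <= mu -> omega * (x0 - x1) <= mu * (b - a) ->
  phi a <= x0 -> phi b <= x1.
Proof.
  intros Hw Hab Hx Hphi Hl Hu Hcos HM Hs Ha.
  replace x1 with (x0 + (x1 - x0) / (b - a) * (b - a)) by (field; lra).
  apply (josephson_supersolution omega l u phi
    (fun t => x0 + (x1 - x0) / (b - a) * (t - a)) (fun _ => (x1 - x0) / (b - a)) a b);
    auto; [lra| | |lra].
  - intros t _. apply is_derive_line.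
  - intros t Ht.
    destruct (line_range x0 x1 a b t Hab Ht) as [s [Hs1 ->]].
    assert (Hc := Hcos t (x0 + s * (x1 - x0)) Ht ltac:(split; nra)).
    assert (Hd := drift_bound M omega mu l u t Hw Hl Hu HM).
    apply Rabs_le_between in Hd. unfold josephson.
    apply Rmult_le_reg_l with omega; [assumption|].
    replace (omega * (_ + l + _)) with
      (cos t - cos (x0 + s * (x1 - x0)) + omega * (l + u * cos t)) by (field; lra).
    apply Rle_trans with (- mu); [lra|].
    apply Rmult_le_reg_r with (b - a); [lra|].
    replace (omega * _ * _) with (- (omega * (x0 - x1))) by (field; lra). lra.
Qed.

Lemma josephson_shift (omega l u : R) (phi : R -> R) (n : nat) :
  josephson_solution omega l u phi ->
  josephson_solution omega l u (fun tau => phi tau - 2 * INR n * PI).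
Proof.
  intros H tau. evar_last.
  - apply (is_derive_minus phi (fun _ => 2 * INR n * PI)); [apply H|].
    apply is_derive_const.
  - unfold josephson, minus, plus, opp, zero; simpl.
    rewrite <- (cos_period (phi tau - 2 * INR n * PI) n).
    replace (phi tau - 2 * INR n * PI + 2 * INR n * PI) with (phi tau) by ring.
    ring.
Qed.

(** The angle is the integral from [c] of [(x y' - y x') / (x^2 + y^2)]. The domain [D] is the whole
    line for the Hermite vector and [(- PI, PI)] for the barrier, whose vector is known to be
    nonzero only where [cos (t / 2) > 0]. *)
Lemma angle_lift (D : R -> Prop) (c a0 : R) (x y dx dy : R -> R) :
  open D -> (forall s t z, D s -> D t -> s <= z <= t -> D z) -> D c ->
  (forall t, D t -> is_derive x t (dx t)) ->
  (forall t, D t -> is_derive y t (dy t)) ->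
  (forall t, D t -> continuous dx t) -> (forall t, D t -> continuous dy t) ->
  (forall t, D t -> 0 < x t ^ 2 + y t ^ 2) ->
  x c = sqrt (x c ^ 2 + y c ^ 2) * cos a0 ->
  y c = sqrt (x c ^ 2 + y c ^ 2) * sin a0 ->
  exists a : R -> R, a c = a0 /\ forall t, D t ->
    is_derive a t ((x t * dy t - y t * dx t) / (x t ^ 2 + y t ^ 2)) /\
    x t = sqrt (x t ^ 2 + y t ^ 2) * cos (a t) /\
    y t = sqrt (x t ^ 2 + y t ^ 2) * sin (a t).
Proof.
  intros HDo HDc Hc Hx Hy Cdx Cdy Hpos Hxc Hyc.
  pose (w := fun t => (x t * dy t - y t * dx t) / (x t ^ 2 + y t ^ 2)).
  assert (Cx : forall t, D t -> continuous x t).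
  { intros t Ht. apply (ex_derive_continuous (V := R_NormedModule)).
    exists (dx t). auto. }
  assert (Cy : forall t, D t -> continuous y t).
  { intros t Ht. apply (ex_derive_continuous (V := R_NormedModule)).
    exists (dy t). auto. }
  assert (Cw : forall t, D t -> continuous w t).
  { intros t Ht.
    apply (continuous_mult (fun t => x t * dy t - y t * dx t)
             (fun t => / (x t ^ 2 + y t ^ 2))).
    - apply (continuous_minus (fun t => x t * dy t) (fun t => y t * dx t)).
      + apply (continuous_mult x dy); auto.
      + apply (continuous_mult y dx); auto.
    - apply (continuous_comp (fun t => x t ^ 2 + y t ^ 2) Rinv).
      + apply (continuous_plus (fun t => x t ^ 2) (fun t => y t ^ 2)); simpl.
        * apply (continuous_mult x (fun t => x t * 1)); auto.
          apply (continuous_mult x (fun t => 1)); auto. apply continuous_const.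
        * apply (continuous_mult y (fun t => y t * 1)); auto.
          apply (continuous_mult y (fun t => 1)); auto. apply continuous_const.
      + apply continuous_Rinv. generalize (Hpos t Ht). lra. }
  assert (Dseg : forall t z, D t -> Rmin c t <= z <= Rmax c t -> D z).
  { intros t z Ht. unfold Rmin, Rmax. destruct (Rle_dec c t); intros Hz.
    - now apply (HDc c t).
    - now apply (HDc t c). }
  pose (a := fun t => a0 + RInt w c t).
  assert (Hac : a c = a0).
  { unfold a. rewrite RInt_point. unfold zero; simpl. ring. }
  assert (Ha : forall t, D t -> is_derive a t (w t)).
  { intros t Ht. unfold a. evar_last.
    - apply (is_derive_plus (fun _ => a0)); [apply is_derive_const|].
      apply (is_derive_RInt w _ c); [|now apply Cw].
      generalize (HDo t Ht). apply filter_imp. intros z Hz.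
      apply (RInt_correct (V := R_CompleteNormedModule)).
      apply (ex_RInt_continuous (V := R_CompleteNormedModule)).
      intros v Hv. apply Cw. now apply (Dseg z).
    - unfold plus, zero; simpl. ring. }
  exists a. split; [exact Hac|]. intros t Ht. split; [now apply Ha|].
  pose (r := fun t => sqrt (x t ^ 2 + y t ^ 2)).
  assert (Hr : forall t, D t -> 0 < r t) by (intros; apply sqrt_lt_R0; auto).
  assert (Hr2 : forall t, D t -> r t * r t = x t ^ 2 + y t ^ 2)
    by (intros; apply sqrt_sqrt; left; auto).
  (* With [u = x/r] and [v = y/r] one has [u' = - w v] and [v' = w u], so
     rotating [(u, v)] by the angle [- a] gives a constant vector. *)
  assert (Hdr : forall t, D t -> is_derive r t ((x t * dx t + y t * dy t) / r t)).
  { intros s Hs. unfold r. evar_last.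
    - apply (is_derive_comp sqrt (fun t => x t ^ 2 + y t ^ 2)).
      + apply is_derive_Reals, derivable_pt_lim_sqrt. auto.
      + apply (is_derive_plus (fun t => x t ^ 2) (fun t => y t ^ 2));
          apply is_derive_pow; auto.
    - unfold scal, plus; simpl. unfold mult; simpl. fold (r s). field.
      generalize (Hr s Hs). unfold r; simpl. lra. }
  assert (Hdu : forall t, D t -> is_derive (fun t => x t / r t) t (- w t * (y t / r t))).
  { intros s Hs. assert (H1 := Hr s Hs). assert (H2 := Hr2 s Hs).
    assert (H3 := Hpos s Hs). evar_last.
    - apply (is_derive_div x r); [now apply Hx|now apply Hdr|lra].
    - unfold w. rewrite <- H2. simpl in H2.
      apply Rmult_eq_reg_r with (r s * (r s * r s)); [|nra].
      replace (_ * (r s * (r s * r s))) with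
        ((dx s * (r s * r s) - x s * (x s * dx s + y s * dy s))) by (field; lra).
      rewrite H2. field. lra. }
  assert (Hdv : forall t, D t -> is_derive (fun t => y t / r t) t (w t * (x t / r t))).
  { intros s Hs. assert (H1 := Hr s Hs). assert (H2 := Hr2 s Hs).
    assert (H3 := Hpos s Hs). evar_last.
    - apply (is_derive_div y r); [now apply Hy|now apply Hdr|lra].
    - unfold w. rewrite <- H2. simpl in H2.
      apply Rmult_eq_reg_r with (r s * (r s * r s)); [|nra].
      replace (_ * (r s * (r s * r s))) with
        ((dy s * (r s * r s) - y s * (x s * dx s + y s * dy s))) by (field; lra).
      rewrite H2. field. lra. }
  assert (Hca : forall t, D t -> is_derive (fun t => cos (a t)) t (- w t * sin (a t))).
  { intros s Hs. evar_last.
    - apply (is_derive_comp cos a); [apply is_derive_Reals, derivable_pt_lim_cos|].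
      now apply Ha.
    - unfold scal; simpl. unfold mult; simpl. ring. }
  assert (Hsa : forall t, D t -> is_derive (fun t => sin (a t)) t (w t * cos (a t))).
  { intros s Hs. evar_last.
    - apply (is_derive_comp sin a); [apply is_derive_Reals, derivable_pt_lim_sin|].
      now apply Ha.
    - unfold scal; simpl. unfold mult; simpl. ring. }
  assert (Hrc := Hr c Hc).
  assert (Huc : x c / r c = cos a0).
  { apply Rmult_eq_reg_r with (r c); [|lra]. unfold Rdiv.
    rewrite Rmult_assoc, Rinv_l, Rmult_1_r, Rmult_comm by lra. exact Hxc. }
  assert (Hvc : y c / r c = sin a0).
  { apply Rmult_eq_reg_r with (r c); [|lra]. unfold Rdiv.
    rewrite Rmult_assoc, Rinv_l, Rmult_1_r, Rmult_comm by lra. exact Hyc. }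
  assert (E1 : x t / r t * cos (a t) + y t / r t * sin (a t) = 1).
  { transitivity (x c / r c * cos (a c) + y c / r c * sin (a c)).
    - symmetry.
      apply (derive_zero_eq (fun t => x t / r t * cos (a t) + y t / r t * sin (a t))).
      intros s Hs. assert (Ds := Dseg t s Ht Hs). evar_last.
      + apply (is_derive_plus (fun t => x t / r t * cos (a t)) (fun t => y t / r t * sin (a t))).
        * apply (is_derive_mult (fun t => x t / r t) (fun t => cos (a t))); auto.
          intros; apply Rmult_comm.
        * apply (is_derive_mult (fun t => y t / r t) (fun t => sin (a t))); auto.
          intros; apply Rmult_comm.
      + unfold plus, mult; simpl. ring.
    - rewrite Hac, Huc, Hvc.
      generalize (sin2_cos2 a0). unfold Rsqr. lra. }
  assert (E2 : y t / r t * cos (a t) - x t / r t * sin (a t) = 0).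
  { transitivity (y c / r c * cos (a c) - x c / r c * sin (a c)).
    - symmetry.
      apply (derive_zero_eq (fun t => y t / r t * cos (a t) - x t / r t * sin (a t))).
      intros s Hs. assert (Ds := Dseg t s Ht Hs). evar_last.
      + apply (is_derive_minus (fun t => y t / r t * cos (a t)) (fun t => x t / r t * sin (a t))).
        * apply (is_derive_mult (fun t => y t / r t) (fun t => cos (a t))); auto.
          intros; apply Rmult_comm.
        * apply (is_derive_mult (fun t => x t / r t) (fun t => sin (a t))); auto.
          intros; apply Rmult_comm.
      + unfold minus, plus, opp, mult; simpl. ring.
    - rewrite Hac, Huc, Hvc.
      ring. }
  fold (r t). assert (Hrt := Hr t Ht).
  assert (Hcs := sin2_cos2 (a t)). unfold Rsqr in Hcs.
  set (U := x t / r t) in *. set (V := y t / r t) in *.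
  assert (HU : U = cos (a t)).
  { transitivity (cos (a t) * (U * cos (a t) + V * sin (a t))
      - sin (a t) * (V * cos (a t) - U * sin (a t))); [|rewrite E1, E2; ring].
    transitivity (U * (sin (a t) * sin (a t) + cos (a t) * cos (a t)));
      [rewrite Hcs|]; ring. }
  assert (HV : V = sin (a t)).
  { transitivity (sin (a t) * (U * cos (a t) + V * sin (a t))
      + cos (a t) * (V * cos (a t) - U * sin (a t))); [|rewrite E1, E2; ring].
    transitivity (V * (sin (a t) * sin (a t) + cos (a t) * cos (a t)));
      [rewrite Hcs|]; ring. }
  rewrite <- HU, <- HV. unfold U, V. split; field; lra.
Qed.

(** * Winding of Hermite polynomials *)

(** The probabilists' (monic) Hermite polynomials [He_n], by their three-term recurrence; the inner
    [match] supplies the missing [He_(-1)]. *)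
Fixpoint hermite (n : nat) (y : R) : R :=
  match n with
  | O => 1
  | S p => y * hermite p y
      - match p with O => 0 | S q => INR p * hermite q y end
  end.

Lemma hermite_SS (n : nat) (y : R) :
  hermite (S (S n)) y = y * hermite (S n) y - INR (S n) * hermite n y.
Proof. reflexivity. Qed.

Lemma hermite_1 (y : R) : hermite 1 y = y.
Proof. simpl. ring. Qed.

(** The two formulas are the rows of one linear system for [(He_n, He_(n+1))], and the inductive
    step for the second row uses both. *)
Lemma hermite_derive (n : nat) (y : R) :
  is_derive (hermite n) y (y * hermite n y - hermite (S n) y) /\
  is_derive (hermite (S n)) y (INR (S n) * hermite n y).
Proof.
  induction n as [|n [IH0 IH1]].
  - split.
    + evar_last; [apply is_derive_const|]. rewrite hermite_1. simpl. unfold zero; simpl. ring.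
    + apply (is_derive_ext (fun y => y)); [intros; symmetry; apply hermite_1|].
      evar_last; [apply is_derive_id|]. simpl. unfold one; simpl. ring.
  - split.
    + evar_last; [exact IH1|]. rewrite hermite_SS. ring.
    + evar_last.
      * apply (is_derive_minus (fun y => y * hermite (S n) y)
                 (fun y => INR (S n) * hermite n y)).
        -- apply (is_derive_mult (fun y => y) (hermite (S n))); [apply is_derive_id|exact IH1|].
           intros; apply Rmult_comm.
        -- apply (is_derive_scal (hermite n)). exact IH0.
      * unfold minus, plus, opp, mult, one; simpl plus.
        rewrite (S_INR (S n)). unfold AbelianGroup.opp, Ring.mult, Ring.one; simpl.
        ring.
Qed.

Lemma hermite_parity (n : nat) (y : R) :
  hermite n (- y) = (-1) ^ n * hermite n y /\
  hermite (S n) (- y) = (-1) ^ S n * hermite (S n) y.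
Proof.
  induction n as [|n [IH0 IH1]].
  - rewrite !hermite_1. simpl. split; ring.
  - split; [exact IH1|]. rewrite !hermite_SS, IH0, IH1. simpl. ring.
Qed.

Lemma hermite_no_common_zero (n : nat) (y : R) :
  hermite n y = 0 -> hermite (S n) y = 0 -> False.
Proof.
  induction n as [|n IH].
  - simpl. lra.
  - rewrite hermite_SS. intros H0 H1. rewrite H0, Rmult_0_r in H1.
    apply IH; [|exact H0].
    assert (INR (S n) <> 0) by (apply not_0_INR; lia).
    assert (INR (S n) * hermite n y = 0) by lra.
    destruct (Rmult_integral _ _ H2); [contradiction|assumption].
Qed.

Lemma hermite_sum_squares_pos (n : nat) (y : R) :
  0 < hermite n y ^ 2 + hermite (S n) y ^ 2.
Proof.
  assert (H0 := pow2_ge_0 (hermite n y)). assert (H1 := pow2_ge_0 (hermite (S n) y)).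
  destruct (Req_dec (hermite n y ^ 2 + hermite (S n) y ^ 2) 0) as [E|E]; [exfalso|lra].
  apply (hermite_no_common_zero n y); apply Rsqr_0_uniq; unfold Rsqr; simpl in *; lra.
Qed.

(** The ratio [R_n = He_(n+1) / He_n] satisfies [R_(n+1) = y - (n+1) / R_n]. For [y^2 >= 4 n] the
    bound [R_n >= y - 2 n / y] gives [R_n >= y / 2], and this closes the induction while showing
    that no zero lies that far out. *)
Lemma hermite_ratio (n : nat) (y : R) :
  0 < y -> 4 * INR n <= y ^ 2 ->
  0 < hermite n y /\
  (y ^ 2 - 2 * INR n) * hermite n y <= y * hermite (S n) y /\
  hermite (S n) y <= y * hermite n y.
Proof.
  intros Hy. induction n as [|n IH]; intros Hn.
  - rewrite hermite_1. simpl. repeat split; nra.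
  - assert (Hp := pos_INR n). rewrite S_INR in *.
    destruct IH as [H0 [H1 H2]]; [lra|].
    assert (HK : 0 < hermite (S n) y) by nra.
    split; [exact HK|]. rewrite hermite_SS, S_INR. split.
    + assert ((y ^ 2 - 2 * INR n) * hermite n y * 1 >= y ^ 2 / 2 * hermite n y) by nra.
      assert (y * hermite n y <= 2 * hermite (S n) y).
      { apply Rmult_le_reg_l with y; [assumption|]. nra. }
      nra.
    + nra.
Qed.

(** Multiplying the bounds by [He_n] makes them even in [y], so parity carries them to the negative
    axis and one statement serves both ends of the barrier. *)
Lemma hermite_ratio_sqr (n : nat) (y : R) :
  y <> 0 -> 4 * INR n <= y ^ 2 ->
  hermite n y <> 0 /\
  (y ^ 2 - 2 * INR n) * hermite n y ^ 2 <= y * hermite (S n) y * hermite n y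
    <= y ^ 2 * hermite n y ^ 2.
Proof.
  assert (Hpos : forall y, 0 < y -> 4 * INR n <= y ^ 2 ->
    hermite n y <> 0 /\
    (y ^ 2 - 2 * INR n) * hermite n y ^ 2 <= y * hermite (S n) y * hermite n y
      <= y ^ 2 * hermite n y ^ 2).
  { intros z Hz Hn. destruct (hermite_ratio n z Hz Hn) as [H0 [H1 H2]].
    split; [lra|split].
    - apply (Rmult_le_compat_r (hermite n z)) in H1; [|lra]. nra.
    - apply (Rmult_le_compat_r (z * hermite n z)) in H2; nra. }
  intros Hy Hn. destruct (Rlt_dec 0 y) as [H|H]; [now apply Hpos|].
  assert (Hy' : 0 < - y) by lra.
  destruct (Hpos (- y) Hy' ltac:(nra)) as [H0 H1].
  destruct (hermite_parity n y) as [-> ->] in H0, H1 |- *.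
  assert (Hs : ((-1) ^ n) ^ 2 = 1).
  { rewrite <- pow_mult, Nat.mul_comm, pow_mult. replace ((-1) ^ 2) with 1 by ring.
    apply pow1. }
  split; [intros E; apply H0; rewrite E; ring|].
  replace (((- y) ^ 2 - 2 * INR n) * ((-1) ^ n * hermite n y) ^ 2)
    with ((y ^ 2 - 2 * INR n) * hermite n y ^ 2 * ((-1) ^ n) ^ 2) in H1 by ring.
  replace (- y * ((-1) ^ S n * hermite (S n) y) * ((-1) ^ n * hermite n y))
    with (y * hermite (S n) y * hermite n y * ((-1) ^ n) ^ 2) in H1 by (simpl; ring).
  replace ((- y) ^ 2 * ((-1) ^ n * hermite n y) ^ 2)
    with (y ^ 2 * hermite n y ^ 2 * ((-1) ^ n) ^ 2) in H1 by ring.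
  rewrite Hs, !Rmult_1_r in H1. exact H1.
Qed.

Lemma hermite_signs_neg (n : nat) (y : R) :
  y < 0 -> 4 * INR n <= y ^ 2 ->
  0 < (-1) ^ n * hermite n y /\ (-1) ^ n * hermite (S n) y <= y / 2 * ((-1) ^ n * hermite n y).
Proof.
  intros Hy Hn.
  destruct (hermite_ratio n (- y) ltac:(lra) ltac:(nra)) as [H0 [H1 _]].
  destruct (hermite_parity n y) as [E0 E1]. rewrite E0, E1 in *.
  split; [exact H0|].
  replace ((-1) ^ S n) with (- (-1) ^ n) in H1 by (simpl; ring).
  apply Rmult_le_reg_l with (- y); [lra|].
  replace ((- y) ^ 2) with (y ^ 2) in H1 by ring. nra.
Qed.

Lemma cos_plus_nat_PI (x : R) (n : nat) : cos (x + INR n * PI) = (-1) ^ n * cos x.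
Proof.
  induction n as [|n IH]; [simpl; rewrite Rmult_0_l, Rplus_0_r; ring|].
  rewrite S_INR. replace (x + (INR n + 1) * PI) with (x + INR n * PI + PI) by ring.
  rewrite neg_cos, IH. simpl. ring.
Qed.

Lemma sin_plus_nat_PI (x : R) (n : nat) : sin (x + INR n * PI) = (-1) ^ n * sin x.
Proof.
  induction n as [|n IH]; [simpl; rewrite Rmult_0_l, Rplus_0_r; ring|].
  rewrite S_INR. replace (x + (INR n + 1) * PI) with (x + INR n * PI + PI) by ring.
  rewrite neg_sin, IH. simpl. ring.
Qed.

Lemma polar_atan (x y : R) :
  0 < x ->
  x = sqrt (x ^ 2 + y ^ 2) * cos (atan (y / x)) /\
  y = sqrt (x ^ 2 + y ^ 2) * sin (atan (y / x)).
Proof.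
  intros Hx. rewrite cos_atan, sin_atan.
  assert (E : sqrt (x ^ 2 + y ^ 2) = x * sqrt (1 + (y / x)²)).
  { rewrite <- (sqrt_pow2 x) at 2 by lra. rewrite <- sqrt_mult_alt by apply pow2_ge_0.
    f_equal. unfold Rsqr. field. lra. }
  assert (0 < sqrt (1 + (y / x)²)).
  { apply sqrt_lt_R0. generalize (Rle_0_sqr (y / x)). lra. }
  rewrite E. split; field; lra.
Qed.

(** A test for two directions not to be opposite: opposite ones have both coordinates of opposite
    sign, or zero together. *)
Lemma cos_minus_neq_opp_1 (a b : R) :
  0 < cos a * cos b \/ (cos a = 0 /\ cos b = 0 /\ 0 < sin a * sin b) ->
  cos (a - b) <> -1.
Proof.
  intros H E.
  assert (Hs : sin (a - b) = 0).
  { apply Rsqr_0_uniq. generalize (sin2_cos2 (a - b)). rewrite E. unfold Rsqr. lra. }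
  assert (Ha : cos a = - cos b).
  { replace a with ((a - b) + b) at 1 by ring. rewrite cos_plus, E, Hs. ring. }
  assert (Hb : sin a = - sin b).
  { replace a with ((a - b) + b) at 1 by ring. rewrite sin_plus, E, Hs. ring. }
  rewrite Ha, Hb in H. destruct H as [H|[_ [_ H]]]; nra.
Qed.

(** Two curves that are never opposite have an angle difference that cannot cross [PI] or [- PI], so
    a count of turns passes from one to the other. The endpoints come in either order because the
    comparison runs from right to left. *)
Lemma confined_below_PI (d : R -> R) (a b : R) :
  (forall t, Rmin a b <= t <= Rmax a b -> continuity_pt d t /\ cos (d t) <> -1) ->
  Rabs (d a) < PI -> Rabs (d b) < PI.
Proof.
  intros H Ha.
  destruct (Rlt_dec (Rabs (d b)) PI) as [|Hn]; [assumption|exfalso].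
  assert (HP : forall t, Rabs (d t) = PI -> cos (d t) = -1).
  { intros t E. unfold Rabs in E. destruct (Rcase_abs (d t)).
    - rewrite <- cos_neg, E. apply cos_PI.
    - rewrite E. apply cos_PI. }
  destruct (Req_dec (Rabs (d b)) PI) as [E|E].
  { apply (H b); [split; [apply Rmin_r|apply Rmax_r]|now apply HP]. }
  destruct (Rle_dec a b) as [Hab|Hab].
  - rewrite Rmin_left, Rmax_right in H by assumption.
    destruct (IVT_interv (fun t => Rabs (d t) - PI) a b) as [z [Hz Ez]].
    + intros t Ht. apply continuity_pt_minus; [|apply continuity_pt_const; now intros ? ?].
      apply (continuity_pt_comp d Rabs); [now apply H|apply Rcontinuity_abs].
    + destruct Hab as [|Eab]; [assumption|subst; lra].
    + lra.
    + lra.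
    + apply (H z Hz), HP. lra.
  - rewrite Rmin_right, Rmax_left in H by lra.
    destruct (IVT_interv (fun t => PI - Rabs (d t)) b a) as [z [Hz Ez]].
    + intros t Ht. apply continuity_pt_minus; [apply continuity_pt_const; now intros ? ?|].
      apply (continuity_pt_comp d Rabs); [now apply H|apply Rcontinuity_abs].
    + lra.
    + lra.
    + lra.
    + apply (H z Hz), HP. lra.
Qed.

Lemma angle_fourth_quadrant (x : R) :
  - PI < x < 3 * PI / 2 -> 0 < cos x -> sin x < 0 -> - (PI / 2) < x < 0.
Proof.
  intros Hx Hc Hs. assert (HP := PI_RGT_0).
  split.
  - destruct (Rlt_dec (- (PI / 2)) x) as [|Hn]; [assumption|exfalso].
    assert (cos (- x) <= 0) by (apply cos_le_0; lra).
    rewrite cos_neg in H. lra.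
  - destruct (Rlt_dec x 0) as [|Hn]; [assumption|exfalso].
    destruct (Rle_dec x PI).
    + assert (0 <= sin x) by (apply sin_ge_0; lra). lra.
    + assert (cos x <= 0) by (apply cos_le_0; lra). lra.
Qed.

Lemma angle_right_half_plane (x : R) :
  - (3 * PI / 2) < x < 3 * PI / 2 -> 0 < cos x -> - (PI / 2) < x < PI / 2.
Proof.
  intros Hx Hc. assert (HP := PI_RGT_0). split.
  - destruct (Rlt_dec (- (PI / 2)) x) as [|Hn]; [assumption|exfalso].
    assert (cos (- x) <= 0) by (apply cos_le_0; lra).
    rewrite cos_neg in H. lra.
  - destruct (Rlt_dec x (PI / 2)) as [|Hn]; [assumption|exfalso].
    assert (cos x <= 0) by (apply cos_le_0; lra). lra.
Qed.

(* Winding of [(He_n, He_(n+1))]: the vectors [(He_(n+1), He_(n+2))] and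
   [(He_(n+1), - He_n)] are never opposite, and the latter is
   [(He_n, He_(n+1))] turned by [- PI / 2]. *)
Lemma hermite_winding (n : nat) (y0 y1 : R) :
  y0 < 0 < y1 -> 4 * INR n <= y0 ^ 2 -> 4 * INR n <= y1 ^ 2 ->
  exists a : R -> R,
    (forall y, continuity_pt a y) /\
    (forall y, exists r, 0 < r /\ hermite n y = r * cos (a y) /\
       hermite (S n) y = r * sin (a y)) /\
    0 < a y1 < PI / 2 /\ - (PI / 2) < a y0 + INR n * PI < 0.
Proof.
  intros [Hy0 Hy1]. assert (HP := PI_RGT_0).
  induction n as [|n IH]; intros Hn0 Hn1.
  - exists atan. repeat split.
    + intros y. apply derivable_continuous_pt, derivable_pt_atan.
    + intros y. exists (sqrt (1 ^ 2 + y ^ 2)). split; [apply sqrt_lt_R0; nra|].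
      rewrite hermite_1. simpl hermite.
      generalize (polar_atan 1 y ltac:(lra)). now rewrite Rdiv_1_r.
    + rewrite <- atan_0. now apply atan_increasing.
    + apply atan_bound.
    + simpl. rewrite Rmult_0_l, Rplus_0_r. generalize (atan_bound y0); lra.
    + simpl. rewrite Rmult_0_l, Rplus_0_r, <- atan_0. now apply atan_increasing.
  - assert (Hn0' : 4 * INR n <= y0 ^ 2) by (rewrite S_INR in Hn0; lra).
    assert (Hn1' : 4 * INR n <= y1 ^ 2) by (rewrite S_INR in Hn1; lra).
    destruct (IH Hn0' Hn1') as [b [Cb [Hb [Hb1 Hb0]]]].
    destruct (hermite_ratio (S n) y1 Hy1 Hn1) as [H0 [H1 _]].
    assert (HK : 0 < hermite (S (S n)) y1).
    { assert (0 < INR (S n)) by (apply lt_0_INR; lia). nra. }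
    destruct (polar_atan _ (hermite (S (S n)) y1) H0) as [Hpx Hpy].
    destruct (angle_lift (fun _ => True) y1
      (atan (hermite (S (S n)) y1 / hermite (S n) y1))
      (hermite (S n)) (hermite (S (S n)))
      (fun y => INR (S n) * hermite n y) (fun y => INR (S (S n)) * hermite (S n) y))
      as [a [Ha1 Ha]]; auto.
    + apply open_true.
    + intros t _. exact (proj2 (hermite_derive n t)).
    + intros t _. exact (proj2 (hermite_derive (S n) t)).
    + intros t _. apply (continuous_scal_r (V := R_NormedModule)).
      apply (ex_derive_continuous (V := R_NormedModule)). eexists. exact (proj1 (hermite_derive n t)).
    + intros t _. apply (continuous_scal_r (V := R_NormedModule)).
      apply (ex_derive_continuous (V := R_NormedModule)). eexists. exact (proj2 (hermite_derive n t)).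
    + intros t _. apply hermite_sum_squares_pos.
    + assert (Ca : forall y, continuity_pt a y).
      { intros y. eapply is_derive_continuity_pt. apply (Ha y I). }
      assert (Hr : forall y, exists r, 0 < r /\ hermite (S n) y = r * cos (a y) /\
         hermite (S (S n)) y = r * sin (a y)).
      { intros y. exists (sqrt (hermite (S n) y ^ 2 + hermite (S (S n)) y ^ 2)).
        split; [apply sqrt_lt_R0, hermite_sum_squares_pos|]. apply (Ha y I). }
      assert (Hlim : 0 < a y1 < PI / 2).
      { rewrite Ha1. split; [|apply atan_bound].
        rewrite <- atan_0. apply atan_increasing. now apply Rdiv_lt_0_compat. }
      exists a. split; [exact Ca|split; [exact Hr|split; [exact Hlim|]]].
      assert (Hd : Rabs (a y0 - (b y0 - PI / 2)) < PI).
      { apply (confined_below_PI (fun y => a y - (b y - PI / 2)) y1 y0).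
        - intros y _. split.
          + apply continuity_pt_minus; [apply Ca|].
            apply continuity_pt_minus; [apply Cb|].
            apply continuity_pt_const. now intros ? ?.
          + apply cos_minus_neq_opp_1.
            replace (cos (b y - PI / 2)) with (sin (b y))
              by (rewrite <- cos_shift, <- cos_neg; f_equal; ring).
            replace (sin (b y - PI / 2)) with (- cos (b y))
              by (rewrite <- sin_shift, <- sin_neg; f_equal; ring).
            destruct (Hb y) as [s [Hs [Hs0 Hs1]]].
            destruct (Hr y) as [r [Hr0 [Hr1 Hr2]]].
            (* Both vectors have first coordinate [He_(n+1)]. At its zeros
               [He_(n+2) = - (n+1) He_n], so the second coordinates agree in sign. *)
            destruct (Req_dec (hermite (S n) y) 0) as [E|E].
            * right.
              assert (Hs2 : sin (b y) = 0).
              { rewrite E in Hs1. apply Rmult_eq_reg_l with s; lra. }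
              assert (Hr3 : cos (a y) = 0).
              { rewrite E in Hr1. apply Rmult_eq_reg_l with r; lra. }
              split; [assumption|split; [assumption|]].
              assert (hermite n y <> 0)
                by (intros E'; now apply (hermite_no_common_zero n y)).
              rewrite hermite_SS, E, Hs0 in Hr2. rewrite Hs0 in H.
              assert (0 < INR (S n)) by (apply lt_0_INR; lia).
              assert (cos (b y) <> 0) by (intros E'; apply H; rewrite E'; ring).
              assert (0 < cos (b y) * cos (b y)) by (now apply Rsqr_pos_lt).
              apply Rmult_lt_reg_l with r; [assumption|].
              replace (r * (sin (a y) * - cos (b y)))
                with (- (r * sin (a y)) * cos (b y)) by ring.
              rewrite <- Hr2.
              replace (r * 0) with 0 by ring.
              replace (- (y * 0 - INR (S n) * (s * cos (b y))) * cos (b y))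
                with (INR (S n) * s * (cos (b y) * cos (b y))) by ring.
              apply Rmult_lt_0_compat; [now apply Rmult_lt_0_compat|assumption].
            * left. apply Rmult_lt_reg_l with (r * s); [now apply Rmult_lt_0_compat|].
              replace (r * s * (cos (a y) * sin (b y)))
                with ((r * cos (a y)) * (s * sin (b y))) by ring.
              rewrite <- Hr1, <- Hs1, Rmult_0_r. now apply Rsqr_pos_lt.
        - apply Rabs_def1; lra. }
      apply Rabs_def2 in Hd.
      destruct (hermite_signs_neg (S n) y0 Hy0 Hn0) as [Hsg0 Hsg1].
      destruct (Hr y0) as [r [Hr0 [Hr1 Hr2]]]. rewrite Hr1, Hr2 in *.
      (* Since [b y0 + n PI] lies in [(- PI / 2, 0)] and [a y0] is within [PI] of [b y0 - PI / 2],
         the angle [a y0 + (n+1) PI] lies in [(- PI, 3 PI / 2)]; the signs of the coordinates then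
         single out the fourth quadrant. *)
      apply angle_fourth_quadrant.
      * rewrite S_INR. lra.
      * rewrite cos_plus_nat_PI. apply Rmult_lt_reg_l with r; [assumption|]. lra.
      * rewrite sin_plus_nat_PI. apply Rmult_lt_reg_l with r; [assumption|]. nra.
Qed.

(** * The Hermite barrier *)

(** Here [x] is the tangent of half the barrier phase, and with [r^2 = omega] the bounds say that it
    equals [rho * tan (t / 2)] up to an error of order [omega]. The factor [C * S] allows one
    statement for both signs of [S]. *)
Lemma hermite_end_ratio (n : nat) (rho r S C : R) :
  0 < rho -> 0 < r -> 0 < C -> S <> 0 -> INR n * r ^ 2 <= S ^ 2 ->
  let H := hermite n (2 / r * S) in
  let x := 2 * rho * (r * hermite (Datatypes.S n) (2 / r * S) - S * H) / (2 * C * H) in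
  rho * (S ^ 2 - INR n * r ^ 2) <= x * C * S <= rho * S ^ 2.
Proof.
  intros Hrho Hr HC HS Hn H x. set (y := 2 / r * S) in *.
  assert (Hry : r * y = 2 * S) by (unfold y; field; lra).
  assert (Hy : y <> 0).
  { intros E. rewrite E in Hry. apply HS. lra. }
  destruct (hermite_ratio_sqr n y Hy) as [H0 [H1 H2]].
  { apply Rmult_le_reg_l with (r ^ 2); [nra|].
    replace (r ^ 2 * y ^ 2) with ((r * y) ^ 2) by ring. rewrite Hry. lra. }
  fold H in H0, H1, H2. set (K := hermite (Datatypes.S n) y) in *.
  assert (HH : 0 < H ^ 2) by (generalize (Rsqr_pos_lt H H0); unfold Rsqr; simpl; lra).
  replace (x * C * S) with (rho * (S * (r * K) * H - S ^ 2 * H ^ 2) / H ^ 2)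
    by (unfold x; field; lra).
  apply (Rmult_le_compat_l (r ^ 2)) in H1; [|nra].
  apply (Rmult_le_compat_l (r ^ 2)) in H2; [|nra].
  replace (r ^ 2 * ((y ^ 2 - 2 * INR n) * H ^ 2))
    with (((r * y) ^ 2 - 2 * INR n * r ^ 2) * H ^ 2) in H1 by ring.
  replace (r ^ 2 * (y * K * H)) with ((r * y) * (r * K) * H) in H1, H2 by ring.
  replace (r ^ 2 * (y ^ 2 * H ^ 2)) with ((r * y) ^ 2 * H ^ 2) in H2 by ring.
  rewrite Hry in H1, H2.
  apply (Rmult_le_compat_l rho) in H1; [|lra].
  apply (Rmult_le_compat_l rho) in H2; [|lra].
  split; apply Rmult_le_reg_r with (H ^ 2); try assumption;
    unfold Rdiv; rewrite (Rmult_assoc _ (/ H ^ 2)), Rinv_l, Rmult_1_r by lra; lra.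
Qed.

(* The barrier is [v = sqrt omega * rho * (Y - 2 He_n'/He_n)] at
   [Y = sigma / sqrt omega], with [He_n' = Y He_n - He_(n+1)]. *)
Lemma hermite_barrier (n : nat) (rho omega ta tb : R) :
  0 < rho -> 0 < omega -> - PI < ta < 0 -> 0 < tb < PI ->
  INR n * omega <= sin (ta / 2) ^ 2 -> INR n * omega <= sin (tb / 2) ^ 2 ->
  exists B dB : R -> R,
    (forall t, - PI < t < PI -> is_derive B t (dB t)) /\
    (forall t, - PI < t < PI -> exists H Z,
       let S := sin (t / 2) in
       let C := cos (t / 2) in
       let N := (2 * C * H) ^ 2 + (2 * rho * Z) ^ 2 in
       0 < N /\
       forall l u,
         let G := l + u * cos t in
         N * omega * (josephson omega l u t (B t) - dB t) =
         4 * (C ^ 2 * (2 * (rho - 1) * (S ^ 2 * H ^ 2 + rho * Z ^ 2))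
              + omega * (C ^ 2 * H ^ 2 * (G - rho * (2 * INR n + 1))
                         + G * rho ^ 2 * Z ^ 2 - rho * S * H * Z))) /\
    (exists x, B ta = 2 * atan x /\
       rho * (sin (ta / 2) ^ 2 - INR n * omega) <= x * cos (ta / 2) * sin (ta / 2)
         <= rho * sin (ta / 2) ^ 2) /\
    (exists x, B tb = 2 * INR n * PI + 2 * atan x /\
       rho * (sin (tb / 2) ^ 2 - INR n * omega) <= x * cos (tb / 2) * sin (tb / 2)
         <= rho * sin (tb / 2) ^ 2).
Proof.
  intros Hrho Hw Hta Htb Hna Hnb. assert (HP := PI_RGT_0).
  pose (r := sqrt omega).
  assert (Hr : 0 < r) by now apply sqrt_lt_R0.
  assert (Hr2 : r ^ 2 = omega) by (simpl; rewrite Rmult_1_r; apply sqrt_sqrt; lra).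
  pose (y := fun t => 2 / r * sin (t / 2)).
  pose (H := fun t => hermite n (y t)). pose (K := fun t => hermite (S n) (y t)).
  pose (dH := fun t => (y t * H t - K t) * (cos (t / 2) / r)).
  pose (dK := fun t => INR (S n) * H t * (cos (t / 2) / r)).
  (* The quotient [q / p] is [v / (2 cos (t / 2))], the tangent of half the barrier phase, with the
     denominator [He_n] cleared. *)
  pose (p := fun t => 2 * cos (t / 2) * H t).
  pose (q := fun t => 2 * rho * (r * K t - sin (t / 2) * H t)).
  pose (dp := fun t => - sin (t / 2) * H t + 2 * cos (t / 2) * dH t).
  pose (dq := fun t => 2 * rho * (r * dK t - (cos (t / 2) / 2 * H t + sin (t / 2) * dH t))).
  assert (Hdy : forall t, is_derive y t (cos (t / 2) / r)).
  { intros t. unfold y. auto_derive; [trivial|unfold Rdiv; field; lra]. }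
  assert (HdH : forall t, is_derive H t (dH t)).
  { intros t. unfold H. evar_last.
    - apply (is_derive_comp (hermite n) y); [exact (proj1 (hermite_derive n (y t)))|apply Hdy].
    - unfold scal, dH; simpl. unfold mult; simpl. unfold H, K. simpl. ring. }
  assert (HdK : forall t, is_derive K t (dK t)).
  { intros t. unfold K. evar_last.
    - apply (is_derive_comp (hermite (S n)) y); [exact (proj2 (hermite_derive n (y t)))|apply Hdy].
    - unfold scal, dK; simpl. unfold mult; simpl. unfold H. ring. }
  assert (HdS : forall t, is_derive (fun t => sin (t / 2)) t (cos (t / 2) / 2))
    by (intros t; auto_derive; [trivial|unfold Rdiv; field]).
  assert (HdC : forall t, is_derive (fun t => cos (t / 2)) t (- sin (t / 2) / 2))
    by (intros t; auto_derive; [trivial|unfold Rdiv; field]).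
  assert (Hdp : forall t, is_derive p t (dp t)).
  { intros t. unfold p, dp. evar_last.
    - apply (is_derive_mult (fun t => 2 * cos (t / 2)) H).
      + apply (is_derive_scal (fun t => cos (t / 2))). apply HdC.
      + apply HdH.
      + intros; apply Rmult_comm.
    - unfold plus, mult; simpl. field. }
  assert (Hdq : forall t, is_derive q t (dq t)).
  { intros t. unfold q, dq.
    apply (is_derive_scal (fun t => r * K t - sin (t / 2) * H t)).
    apply (is_derive_minus (fun t => r * K t) (fun t => sin (t / 2) * H t)).
    - apply (is_derive_scal K). apply HdK.
    - apply (is_derive_mult (fun t => sin (t / 2)) H); [apply HdS|apply HdH|].
      intros; apply Rmult_comm. }
  assert (ExH : forall t, ex_derive H t) by (intros; eexists; apply HdH).
  assert (ExK : forall t, ex_derive K t) by (intros; eexists; apply HdK).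
  assert (Exy : forall t, ex_derive y t) by (intros; eexists; apply Hdy).
  assert (HCpos : forall t, - PI < t < PI -> 0 < cos (t / 2))
    by (intros; apply cos_gt_0; lra).
  assert (Hpq : forall t, - PI < t < PI -> 0 < p t ^ 2 + q t ^ 2).
  { intros t Ht. assert (HC := HCpos t Ht).
    assert (Hp0 := pow2_ge_0 (p t)). assert (Hq0 := pow2_ge_0 (q t)).
    destruct (Req_dec (p t) 0) as [E|E].
    - assert (EH : H t = 0).
      { unfold p in E. apply Rmult_eq_reg_l with (2 * cos (t / 2)); lra. }
      assert (EK : K t <> 0) by (intros EK; now apply (hermite_no_common_zero n (y t))).
      assert (q t <> 0).
      { unfold q. rewrite EH. replace (_ * _) with (2 * rho * r * K t) by ring.
        repeat apply Rmult_integral_contrapositive_currified; lra. }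
      generalize (Rsqr_pos_lt _ H0). unfold Rsqr. simpl in *. lra.
    - generalize (Rsqr_pos_lt _ E). unfold Rsqr. simpl in *. lra. }
  assert (HSa : sin (ta / 2) < 0).
  { rewrite <- (Ropp_involutive (ta / 2)), sin_neg.
    assert (0 < sin (- (ta / 2))) by (apply sin_gt_0; lra). lra. }
  assert (HSb : 0 < sin (tb / 2)) by (apply sin_gt_0; lra).
  assert (Hy2 : forall t, r ^ 2 * y t ^ 2 = 4 * sin (t / 2) ^ 2)
    by (intros; unfold y; field; lra).
  assert (Hna' : 4 * INR n <= y ta ^ 2).
  { apply Rmult_le_reg_l with (r ^ 2); [nra|]. rewrite Hy2. nra. }
  assert (Hnb' : 4 * INR n <= y tb ^ 2).
  { apply Rmult_le_reg_l with (r ^ 2); [nra|]. rewrite Hy2. nra. }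
  assert (H2r : 0 < 2 / r) by (apply Rdiv_lt_0_compat; lra).
  assert (Hya : y ta < 0) by (unfold y; nra).
  assert (Hyb : 0 < y tb) by (unfold y; nra).
  destruct (hermite_winding n (y ta) (y tb) (conj Hya Hyb) Hna' Hnb')
    as [a [Ca [Hpol [Hab Haa]]]].
  assert (Hpb : 0 < p tb).
  { unfold p. assert (0 < cos (tb / 2)) by (apply HCpos; lra).
    destruct (hermite_ratio n (y tb) Hyb Hnb') as [HH _]. fold (H tb) in HH. nra. }
  destruct (polar_atan (p tb) (q tb) Hpb) as [Hpol1 Hpol2].
  destruct (angle_lift (fun t => - PI < t < PI) tb (atan (q tb / p tb)) p q dp dq)
    as [A [HAb HA]]; auto.
  - apply (open_and (fun t => - PI < t) (fun t => t < PI)); [apply open_gt|apply open_lt].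
  - intros s t z Hs Ht Hz. lra.
  - lra.
  - intros t _. apply (ex_derive_continuous (V := R_NormedModule)).
    unfold dp, dH. auto_derive. repeat split; auto; lra.
  - intros t _. apply (ex_derive_continuous (V := R_NormedModule)).
    unfold dq, dH, dK. auto_derive. repeat split; auto; lra.
  (* The vector [(p, q)] makes [n] half-turns, hence the doubled angle makes [n] turns; the constant
     brings the phase at [ta] into [(- PI, PI)]. *)
  - exists (fun t => 2 * A t + 2 * INR n * PI).
    exists (fun t => 2 * ((p t * dq t - q t * dp t) / (p t ^ 2 + q t ^ 2))).
    split; [|split; [|split]].
    + intros t Ht. evar_last.
      * apply (is_derive_plus (fun t => 2 * A t) (fun _ => 2 * INR n * PI)).
        -- apply (is_derive_scal A). apply (HA t Ht).
        -- apply is_derive_const.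
      * unfold plus, zero; simpl. ring.
    + intros t Ht. exists (H t), (r * K t - sin (t / 2) * H t).
      intros S C N.
      assert (HN : N = p t ^ 2 + q t ^ 2) by reflexivity.
      split; [rewrite HN; now apply Hpq|]. intros l u G.
      destruct (HA t Ht) as [_ [Hp Hq]]. assert (HNpos := Hpq t Ht).
      rewrite <- HN in *.
      assert (HsN := sqrt_sqrt N ltac:(lra)).
      assert (Hcos : N * cos (2 * A t + 2 * INR n * PI) = p t ^ 2 - q t ^ 2).
      { rewrite cos_period, cos_2a. rewrite Hp, Hq, <- HsN at 1. ring. }
      assert (Hcost : cos t = C * C - S * S).
      { unfold C, S. rewrite <- cos_2a. f_equal. field. }
      assert (HCS : S * S + C * C = 1) by apply sin2_cos2.
      unfold josephson. fold G.
      replace (N * omega * _) with (N * cos t - N * cos (2 * A t + 2 * INR n * PI)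
        + omega * G * N - 2 * (r ^ 2 * (p t * dq t - q t * dp t)))
        by (unfold G; rewrite Hr2; field; lra).
      rewrite Hcos.
      replace (N * cos t - (p t ^ 2 - q t ^ 2))
        with (2 * (C * C) * q t ^ 2 - 2 * (S * S) * p t ^ 2).
      2: { rewrite Hcost, HN.
           replace (C * C) with (1 - S * S) by lra. ring. }
      rewrite HN. unfold dp, dq, dH, dK. rewrite S_INR.
      unfold p, q. unfold y. fold S C. rewrite <- Hr2. field. lra.
    + exists (q ta / p ta).
      assert (HCa : 0 < cos (ta / 2)) by (apply HCpos; lra).
      split.
      2: { generalize (hermite_end_ratio n rho r (sin (ta / 2)) (cos (ta / 2))).
           rewrite Hr2. intros E. apply E; lra. }
      (* The vectors [(p, q)] and [(He_n, He_(n+1))] are never opposite: [p] is a positive multiple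
         of [He_n], and where [He_n] vanishes [q] is a positive multiple of [He_(n+1)]. So [(p, q)]
         inherits the winding of the Hermite vector. *)
      assert (Hd : Rabs (A ta - a (y ta)) < PI).
      { apply (confined_below_PI (fun t => A t - a (y t)) tb ta).
        - rewrite Rmin_right, Rmax_left by lra. intros t Ht.
          assert (Ht' : - PI < t < PI) by lra. split.
          + apply continuity_pt_minus.
            * eapply is_derive_continuity_pt, (HA t Ht').
            * apply (continuity_pt_comp y a); [eapply is_derive_continuity_pt, Hdy|apply Ca].
          + apply cos_minus_neq_opp_1.
            assert (Hs := sqrt_lt_R0 _ (Hpq t Ht')).
            destruct (HA t Ht') as [_ [Hp Hq]].
            set (s := sqrt (p t ^ 2 + q t ^ 2)) in *.
            destruct (Hpol (y t)) as [s' [Hs' [HH HK]]].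
            assert (HC := HCpos t Ht').
            fold (H t) in HH. fold (K t) in HK.
            destruct (Req_dec (H t) 0) as [E|E].
            * right.
              assert (E1 : cos (A t) = 0).
              { unfold p in Hp. rewrite E, Rmult_0_r in Hp.
                apply Rmult_eq_reg_l with s; lra. }
              assert (E2 : cos (a (y t)) = 0).
              { rewrite E in HH. apply Rmult_eq_reg_l with s'; lra. }
              split; [exact E1|split; [exact E2|]].
              assert (HK0 : K t <> 0) by (intros EK; now apply (hermite_no_common_zero n (y t))).
              unfold q in Hq. rewrite E in Hq.
              apply Rmult_lt_reg_l with (s * s'); [now apply Rmult_lt_0_compat|].
              replace (s * s' * (sin (A t) * sin (a (y t))))
                with ((s * sin (A t)) * (s' * sin (a (y t)))) by ring.
              rewrite <- Hq, <- HK, Rmult_0_r.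
              replace (2 * rho * (r * K t - sin (t / 2) * 0) * K t)
                with (2 * (rho * r * (K t * K t))) by ring.
              generalize (Rsqr_pos_lt _ HK0). unfold Rsqr. intros.
              apply Rmult_lt_0_compat; [lra|].
              apply Rmult_lt_0_compat; [now apply Rmult_lt_0_compat|assumption].
            * left.
              apply Rmult_lt_reg_l with (s * s'); [now apply Rmult_lt_0_compat|].
              replace (s * s' * (cos (A t) * cos (a (y t))))
                with ((s * cos (A t)) * (s' * cos (a (y t)))) by ring.
              rewrite <- Hp, <- HH, Rmult_0_r. unfold p.
              replace (2 * cos (t / 2) * H t * H t) with (2 * (cos (t / 2) * (H t * H t))) by ring.
              generalize (Rsqr_pos_lt _ E). unfold Rsqr. intros.
              apply Rmult_lt_0_compat; [lra|]. now apply Rmult_lt_0_compat.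
        - rewrite HAb. destruct (atan_bound (q tb / p tb)). apply Rabs_def1; lra. }
      apply Rabs_def2 in Hd.
      destruct (HA ta ltac:(lra)) as [_ [Hp Hq]].
      assert (Hs := sqrt_lt_R0 _ (Hpq ta ltac:(lra))). set (s := sqrt (p ta ^ 2 + q ta ^ 2)) in *.
      destruct (hermite_signs_neg n (y ta) Hya Hna') as [Hsg _]. fold (H ta) in Hsg.
      assert (Hsg' : 0 < (-1) ^ n * cos (A ta)).
      { apply Rmult_lt_reg_l with s; [assumption|].
        replace (s * ((-1) ^ n * cos (A ta))) with ((-1) ^ n * (s * cos (A ta))) by ring.
        rewrite <- Hp. unfold p. nra. }
      assert (Hq1 : - (PI / 2) < A ta + INR n * PI < PI / 2).
      { apply angle_right_half_plane; [lra|]. now rewrite cos_plus_nat_PI. }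
      replace (q ta / p ta) with (tan (A ta + INR n * PI)).
      * rewrite atan_tan by lra. ring.
      * unfold tan. rewrite sin_plus_nat_PI, cos_plus_nat_PI, Hp, Hq.
        assert ((-1) ^ n <> 0) by (apply pow_nonzero; lra).
        assert (cos (A ta) <> 0) by (intros E; rewrite E in Hsg'; lra).
        field. repeat split; lra.
    + exists (q tb / p tb).
      assert (HCb : 0 < cos (tb / 2)) by (apply HCpos; lra).
      split; [rewrite HAb; ring|].
      generalize (hermite_end_ratio n rho r (sin (tb / 2)) (cos (tb / 2))).
      rewrite Hr2. intros E. apply E; lra.
Qed.

(** * Passage through the tangency *)

Lemma cos_Rabs (x : R) : cos (Rabs x) = cos x.
Proof.
  unfold Rabs. destruct (Rcase_abs x); [apply cos_neg|reflexivity].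
Qed.

Lemma cos_le_abs (x y : R) : Rabs x <= Rabs y <= PI -> cos y <= cos x.
Proof.
  intros H. rewrite <- (cos_Rabs x), <- (cos_Rabs y). assert (Hx := Rabs_pos x).
  apply cos_decr_1; lra.
Qed.

Lemma cos_lt_abs (x y : R) : Rabs x < Rabs y <= PI -> cos y < cos x.
Proof.
  intros H. rewrite <- (cos_Rabs x), <- (cos_Rabs y). assert (Hx := Rabs_pos x).
  apply cos_decreasing_1; lra.
Qed.

(** The common shape of the smallness conditions on [omega]: with [P] and [Q] independent of [l] and
    [u], finitely many of them combine by [filter_and]. *)
Lemma at_right_0_mult_le (P Q : R) :
  0 < P -> at_right 0 (fun w => 0 < w /\ w * Q <= P).
Proof.
  intros HP. assert (HQ : 0 < Rabs Q + 1) by (generalize (Rabs_pos Q); lra).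
  exists (mkposreal _ (Rdiv_lt_0_compat _ _ HP HQ)). intros w Hw Hw0. split; [exact Hw0|].
  simpl in Hw. change (Rabs (w - 0) < P / (Rabs Q + 1)) in Hw.
  rewrite Rminus_0_r, Rabs_pos_eq in Hw by lra.
  apply (Rmult_lt_compat_r (Rabs Q + 1)) in Hw; [|lra].
  unfold Rdiv in Hw. rewrite Rmult_assoc, Rinv_l in Hw by lra.
  assert (HQ' := Rle_abs Q). nra.
Qed.

(** The leading part is at least [eta / 2 * (a + b)] with [a = (S H)^2], [b = Z^2], and it absorbs
    every term of order [omega] except [C^2 H^2 (G - rho N)], which need not be small where [S = 0].
    There the hypothesis on [u + l] provides the sign. [N] stands for [2n+1]. *)
Lemma barrier_form_nonneg (eta M omega l u N S C H Z : R) :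
  0 < eta <= 1 / 2 -> 0 < omega -> Rabs l <= M -> Rabs u <= M ->
  omega * (8 * M + 1) <= eta / 4 -> 1 / 4 <= C ^ 2 -> S ^ 2 + C ^ 2 = 1 ->
  (1 + eta) * N <= u + l ->
  let rho := 1 + eta in
  let G := l + u * (1 - 2 * S ^ 2) in
  0 <= C ^ 2 * (2 * (rho - 1) * (S ^ 2 * H ^ 2 + rho * Z ^ 2))
       + omega * (C ^ 2 * H ^ 2 * (G - rho * N) + G * rho ^ 2 * Z ^ 2 - rho * S * H * Z).
Proof.
  intros Heta Hw Hl Hu HM HC HSC HN rho G. unfold rho.
  apply Rabs_le_between in Hl, Hu.
  set (a := S ^ 2 * H ^ 2). set (b := Z ^ 2).
  assert (Ha : 0 <= a) by (unfold a; rewrite <- Rpow_mult_distr; apply pow2_ge_0).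
  assert (Hb : 0 <= b) by apply pow2_ge_0.
  assert (HS2 := pow2_ge_0 S). assert (HH2 := pow2_ge_0 H).
  assert (HSHZ : S * H * Z <= (a + b) / 2).
  { unfold a, b. generalize (pow2_ge_0 (S * H - Z)). lra. }
  assert (HG : - (2 * M) <= G) by (unfold G; nra).
  assert (T1 : eta / 2 * (a + b) <= C ^ 2 * (2 * (1 + eta - 1) * (a + (1 + eta) * b))).
  { assert (0 <= (C ^ 2 - 1 / 4) * (2 * eta * (a + (1 + eta) * b))).
    { apply Rmult_le_pos; [lra|]. apply Rmult_le_pos; [lra|].
      assert (0 <= (1 + eta) * b) by (apply Rmult_le_pos; lra). lra. }
    assert (0 <= eta * (eta * b)) by (apply Rmult_le_pos; [|apply Rmult_le_pos]; lra).
    lra. }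
  (* [G] differs from [u + l] by [2 u S^2], and multiplied by [H^2] this difference becomes a
     multiple of [a]. *)
  assert (T2 : - (2 * M * a) <= C ^ 2 * H ^ 2 * (G - (1 + eta) * N)).
  { assert (E : 0 <= C ^ 2 * H ^ 2 * (G - (1 + eta) * N + 2 * u * S ^ 2)).
    { apply Rmult_le_pos; [apply Rmult_le_pos; lra|]. unfold G. lra. }
    assert (E2 : C ^ 2 * H ^ 2 * (2 * u * S ^ 2) = C ^ 2 * (2 * (u * a)))
      by (unfold a; ring).
    assert (u * a <= M * a) by (apply Rmult_le_compat_r; lra).
    assert (0 <= M * a) by (apply Rmult_le_pos; lra).
    assert (C ^ 2 * (2 * (u * a)) <= C ^ 2 * (2 * (M * a)))
      by (apply Rmult_le_compat_l; lra).
    assert (C ^ 2 * (2 * (M * a)) <= 1 * (2 * (M * a)))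
      by (apply Rmult_le_compat_r; lra).
    lra. }
  assert (T3 : - (2 * M) * (9 / 4 * b) <= G * (1 + eta) ^ 2 * b).
  { assert (E : (1 + eta) ^ 2 <= 9 / 4) by nra.
    assert (E0 : 0 <= (1 + eta) ^ 2) by apply pow2_ge_0.
    assert (0 <= (G + 2 * M) * ((1 + eta) ^ 2 * b))
      by (apply Rmult_le_pos; [lra|apply Rmult_le_pos; lra]).
    assert (0 <= 2 * M * ((9 / 4 - (1 + eta) ^ 2) * b))
      by (apply Rmult_le_pos; [lra|apply Rmult_le_pos; lra]).
    lra. }
  assert (T4 : (1 + eta) * S * H * Z <= 3 / 4 * (a + b)).
  { assert (0 <= (1 + eta) * ((a + b) / 2 - S * H * Z)) by (apply Rmult_le_pos; lra).
    assert (0 <= (1 / 2 - eta) * (a + b)) by (apply Rmult_le_pos; lra). lra. }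
  assert (T5 : omega * (8 * M + 1) * (a + b) <= eta / 4 * (a + b))
    by (apply Rmult_le_compat_r; lra).
  assert (T6 : omega * (- (8 * M + 1) * (a + b)) <=
    omega * (C ^ 2 * H ^ 2 * (G - (1 + eta) * N) + G * (1 + eta) ^ 2 * b
             - (1 + eta) * S * H * Z)).
  { apply Rmult_le_compat_l; [lra|].
    assert (0 <= M * a) by (apply Rmult_le_pos; lra).
    assert (0 <= M * b) by (apply Rmult_le_pos; lra). lra. }
  assert (0 <= eta * (a + b)) by (apply Rmult_le_pos; lra).
  lra.
Qed.

(** The mirror estimate. The leading part is now only known to be at most [- eta / 4 * (a + b)],
    exactly what the smallness of [omega] allows the remaining terms to consume. *)
Lemma barrier_form_nonpos (eta M omega l u N S C H Z : R) :
  0 < eta <= 1 / 2 -> 0 < omega -> Rabs l <= M -> Rabs u <= M ->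
  omega * (8 * M + 1) <= eta / 4 -> 1 / 4 <= C ^ 2 -> S ^ 2 + C ^ 2 = 1 ->
  u + l <= (1 - eta) * N ->
  let rho := 1 - eta in
  let G := l + u * (1 - 2 * S ^ 2) in
  C ^ 2 * (2 * (rho - 1) * (S ^ 2 * H ^ 2 + rho * Z ^ 2))
    + omega * (C ^ 2 * H ^ 2 * (G - rho * N) + G * rho ^ 2 * Z ^ 2 - rho * S * H * Z) <= 0.
Proof.
  intros Heta Hw Hl Hu HM HC HSC HN rho G. unfold rho.
  apply Rabs_le_between in Hl, Hu.
  set (a := S ^ 2 * H ^ 2). set (b := Z ^ 2).
  assert (Ha : 0 <= a) by (unfold a; rewrite <- Rpow_mult_distr; apply pow2_ge_0).
  assert (Hb : 0 <= b) by apply pow2_ge_0.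
  assert (HS2 := pow2_ge_0 S). assert (HH2 := pow2_ge_0 H).
  assert (HSHZ : - (S * H * Z) <= (a + b) / 2).
  { unfold a, b. generalize (pow2_ge_0 (S * H + Z)). lra. }
  assert (HG : G <= 2 * M) by (unfold G; nra).
  assert (T1 : C ^ 2 * (2 * (1 - eta - 1) * (a + (1 - eta) * b)) <= - (eta / 4 * (a + b))).
  { assert (0 <= (C ^ 2 - 1 / 4) * (2 * eta * (a + (1 - eta) * b))).
    { apply Rmult_le_pos; [lra|]. apply Rmult_le_pos; [lra|].
      assert (0 <= (1 - eta) * b) by (apply Rmult_le_pos; lra). lra. }
    assert (0 <= eta * ((1 / 2 - eta) * b)) by (apply Rmult_le_pos; [|apply Rmult_le_pos]; lra).
    assert (0 <= eta * a) by (apply Rmult_le_pos; lra).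
    lra. }
  assert (T2 : C ^ 2 * H ^ 2 * (G - (1 - eta) * N) <= 2 * M * a).
  { assert (E : 0 <= C ^ 2 * H ^ 2 * (- (G - (1 - eta) * N + 2 * u * S ^ 2))).
    { apply Rmult_le_pos; [apply Rmult_le_pos; lra|]. unfold G. lra. }
    assert (E2 : C ^ 2 * H ^ 2 * (2 * u * S ^ 2) = C ^ 2 * (2 * (u * a)))
      by (unfold a; ring).
    assert (- M * a <= u * a) by (apply Rmult_le_compat_r; lra).
    assert (0 <= M * a) by (apply Rmult_le_pos; lra).
    assert (C ^ 2 * (2 * (- M * a)) <= C ^ 2 * (2 * (u * a)))
      by (apply Rmult_le_compat_l; lra).
    assert (C ^ 2 * (2 * (M * a)) <= 1 * (2 * (M * a)))
      by (apply Rmult_le_compat_r; lra).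
    lra. }
  assert (T3 : G * (1 - eta) ^ 2 * b <= 2 * M * b).
  { assert (E : (1 - eta) ^ 2 <= 1) by nra.
    assert (E0 : 0 <= (1 - eta) ^ 2) by apply pow2_ge_0.
    assert (0 <= (2 * M - G) * ((1 - eta) ^ 2 * b))
      by (apply Rmult_le_pos; [lra|apply Rmult_le_pos; lra]).
    assert (0 <= 2 * M * ((1 - (1 - eta) ^ 2) * b))
      by (apply Rmult_le_pos; [lra|apply Rmult_le_pos; lra]).
    lra. }
  assert (T4 : - ((1 - eta) * S * H * Z) <= 1 / 2 * (a + b)).
  { assert (0 <= (1 - eta) * ((a + b) / 2 + S * H * Z)) by (apply Rmult_le_pos; lra).
    assert (0 <= eta * (a + b)) by (apply Rmult_le_pos; lra). lra. }
  assert (T5 : omega * (8 * M + 1) * (a + b) <= eta / 4 * (a + b))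
    by (apply Rmult_le_compat_r; lra).
  assert (T6 : omega * (C ^ 2 * H ^ 2 * (G - (1 - eta) * N) + G * (1 - eta) ^ 2 * b
             - (1 - eta) * S * H * Z) <= omega * ((8 * M + 1) * (a + b))).
  { apply Rmult_le_compat_l; [lra|].
    assert (0 <= M * a) by (apply Rmult_le_pos; lra).
    assert (0 <= M * b) by (apply Rmult_le_pos; lra). lra. }
  lra.
Qed.

Lemma cos_half_sqr_ge (t : R) :
  - (2 * PI / 3) <= t <= PI / 3 -> 1 / 4 <= cos (t / 2) ^ 2.
Proof.
  intros Ht. assert (HP := PI_RGT_0).
  assert (1 / 2 <= cos (t / 2)).
  { rewrite <- cos_PI3. apply cos_le_abs.
    rewrite (Rabs_pos_eq (PI / 3)) by lra. split; [apply Rabs_le|]; lra. }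
  simpl. nra.
Qed.

(* A barrier steeper than the slow manifold by a factor
   [k] lies beyond the ends [- 2 PI / 3] and [PI / 3] of the segment
   already at [ta] and [tb]. *)
Lemma matching_times (k : R) :
  1 < k ->
  exists ta tb, - (2 * PI / 3) < ta < 0 /\ 0 < tb < PI / 3 /\
    2 * atan (k * tan (ta / 2)) < - (2 * PI / 3) /\
    PI / 3 < 2 * atan (k * tan (tb / 2)).
Proof.
  intros Hk. assert (HP := PI_RGT_0).
  (* Dividing the tangent at the target angle by [k'] moves the time strictly inside the segment, as
     [1 < k']; multiplying by [k] then overshoots the target, as [k' < k]. *)
  pose (k' := (1 + k) / 2).
  assert (Hk' : 1 < k' < k) by (unfold k'; lra).
  assert (Hinv : 0 < / k' < 1).
  { split; [apply Rinv_0_lt_compat; lra|]. rewrite <- Rinv_1. apply Rinv_lt_contravar; lra. }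
  assert (Hkk : 1 < k * / k').
  { apply Rmult_lt_reg_r with k'; [lra|]. rewrite Rmult_assoc, Rinv_l; lra. }
  assert (Hgen : forall z, 0 < z < PI / 2 ->
    0 < atan (tan z * / k') < z /\ z < atan (k * tan (atan (tan z * / k')))).
  { intros z Hz. assert (Htan : 0 < tan z) by (apply tan_gt_0; lra).
    rewrite tan_atan.
    split; [split|].
    - rewrite <- atan_0. apply atan_increasing. nra.
    - rewrite <- (atan_tan z) at 2 by lra. apply atan_increasing. nra.
    - rewrite <- (atan_tan z) at 1 by lra. apply atan_increasing. nra. }
  destruct (Hgen (PI / 3) ltac:(lra)) as [A1 A2].
  destruct (Hgen (PI / 6) ltac:(lra)) as [B1 B2].
  set (za := atan (tan (PI / 3) * / k')) in *. set (zb := atan (tan (PI / 6) * / k')) in *.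
  exists (- (2 * za)), (2 * zb).
  replace (- (2 * za) / 2) with (- za) by field. replace (2 * zb / 2) with zb by field.
  rewrite tan_neg, Ropp_mult_distr_r_reverse, atan_opp.
  repeat split; lra.
Qed.

Lemma atan_double_bound (x : R) : - PI < 2 * atan x < PI.
Proof. generalize (atan_bound x). lra. Qed.

Lemma ratio_le_of_neg (x k C S : R) :
  0 < C -> S < 0 -> k * S ^ 2 <= x * C * S -> x <= k * (S / C).
Proof.
  intros HC HS H. apply Rmult_le_reg_r with (C * - S); [nra|].
  replace (k * (S / C) * (C * - S)) with (- (k * S ^ 2)) by (field; lra). lra.
Qed.

Lemma ratio_ge_of_neg (x k C S : R) :
  0 < C -> S < 0 -> x * C * S <= k * S ^ 2 -> k * (S / C) <= x.
Proof.
  intros HC HS H. apply Rmult_le_reg_r with (C * - S); [nra|].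
  replace (k * (S / C) * (C * - S)) with (- (k * S ^ 2)) by (field; lra). lra.
Qed.

Lemma ratio_ge_of_pos (x k C S : R) :
  0 < C -> 0 < S -> k * S ^ 2 <= x * C * S -> k * (S / C) <= x.
Proof.
  intros HC HS H. apply Rmult_le_reg_r with (C * S); [nra|].
  replace (k * (S / C) * (C * S)) with (k * S ^ 2) by (field; lra). lra.
Qed.

Lemma ratio_le_of_pos (x k C S : R) :
  0 < C -> 0 < S -> x * C * S <= k * S ^ 2 -> x <= k * (S / C).
Proof.
  intros HC HS H. apply Rmult_le_reg_r with (C * S); [nra|].
  replace (k * (S / C) * (C * S)) with (k * S ^ 2) by (field; lra). lra.
Qed.

Lemma half_angle_signs (ta tb : R) :
  - (2 * PI / 3) < ta < 0 -> 0 < tb < PI / 3 ->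
  sin (ta / 2) < 0 /\ 0 < cos (ta / 2) /\ 0 < sin (tb / 2) /\ 0 < cos (tb / 2).
Proof.
  intros Ha Hb. assert (HP := PI_RGT_0). repeat split.
  - rewrite <- (Ropp_involutive (ta / 2)), sin_neg.
    assert (0 < sin (- (ta / 2))) by (apply sin_gt_0; lra). lra.
  - apply cos_gt_0; lra.
  - apply sin_gt_0; lra.
  - apply cos_gt_0; lra.
Qed.

Lemma atan_le (x y : R) : x <= y -> atan x <= atan y.
Proof.
  intros [H|H]; [left; now apply atan_increasing|subst; apply Rle_refl].
Qed.

(** The Hermite barrier with [rho = 1 + eta] passes from below the attracting half of [phi = tau] to
    above the repelling half, [n] turns later. Straight climbs join its ends to those of the
    segment, and the last one carries the phase past another half-turn. *)
Lemma josephson_lower (n : nat) (eps M : R) :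
  0 < eps -> at_right 0 (fun omega => forall l u phi,
    Rabs l <= M -> Rabs u <= M -> 2 * INR n + 1 + eps <= u + l ->
    josephson_solution omega l u phi ->
    - PI <= phi (- (2 * PI / 3)) -> 2 * INR n * PI + PI < phi (PI / 3)).
Proof.
  intros Heps. assert (HP := PI_RGT_0). assert (Hn := pos_INR n).
  pose (eta := Rmin (1 / 2) (eps / (2 * INR n + 1))).
  assert (Heta : 0 < eta <= 1 / 2).
  { split; [|apply Rmin_l]. apply Rmin_pos; [lra|]. apply Rdiv_lt_0_compat; lra. }
  assert (Heta2 : (1 + eta) * (2 * INR n + 1) <= 2 * INR n + 1 + eps).
  { assert (E := Rmin_r (1 / 2) (eps / (2 * INR n + 1))). fold eta in E.
    apply (Rmult_le_compat_r (2 * INR n + 1)) in E; [|lra].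
    unfold Rdiv in E at 1. rewrite Rmult_assoc, Rinv_l in E by lra. lra. }
  (* The end estimates of the barrier lose [rho * n * omega]. Half of [eta] pays for this loss, so
     the barrier remains steeper than the slow curve by the factor [k]. *)
  pose (k := 1 + eta / 2).
  destruct (matching_times k ltac:(unfold k; lra)) as [ta [tb [Hta [Htb [HLa HLb]]]]].
  destruct (half_angle_signs ta tb Hta Htb) as [HSa [HCa [HSb HCb]]].
  pose (La := 2 * atan (k * tan (ta / 2))). pose (Lb := 2 * atan (k * tan (tb / 2))).
  fold La in HLa. fold Lb in HLb.
  assert (BLa := atan_double_bound (k * tan (ta / 2))). fold La in BLa.
  assert (BLb := atan_double_bound (k * tan (tb / 2))). fold Lb in BLb.
  pose (mua := (cos (- (2 * PI / 3)) - cos La) / 2).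
  pose (mub := (cos (PI / 3) - cos Lb) / 2).
  assert (Hmua : 0 < mua).
  { assert (cos La < cos (- (2 * PI / 3))); [|unfold mua; lra].
    apply cos_lt_abs. rewrite !Rabs_left by lra. lra. }
  assert (Hmub : 0 < mub).
  { assert (cos Lb < cos (PI / 3)); [|unfold mub; lra].
    apply cos_lt_abs. rewrite !Rabs_pos_eq by lra. lra. }
  assert (HSa2 : 0 < sin (ta / 2) ^ 2) by nra.
  assert (HSb2 : 0 < sin (tb / 2) ^ 2) by nra.
  assert (Hek : 1 + eta - k = eta / 2) by (unfold k; field).
  generalize (filter_and (F := at_right 0) _ _
    (at_right_0_mult_le (sin (ta / 2) ^ 2) (INR n) HSa2) (filter_and (F := at_right 0) _ _
    (at_right_0_mult_le (sin (tb / 2) ^ 2) (INR n) HSb2) (filter_and (F := at_right 0) _ _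
    (at_right_0_mult_le (eta / 2 * sin (ta / 2) ^ 2) ((1 + eta) * INR n) ltac:(nra))
    (filter_and (F := at_right 0) _ _
    (at_right_0_mult_le (eta / 2 * sin (tb / 2) ^ 2) ((1 + eta) * INR n) ltac:(nra))
    (filter_and (F := at_right 0) _ _
    (at_right_0_mult_le (eta / 4) (8 * M + 1) ltac:(lra)) (filter_and (F := at_right 0) _ _
    (at_right_0_mult_le mua (2 * M) Hmua) (filter_and (F := at_right 0) _ _
    (at_right_0_mult_le mub (2 * M) Hmub) (filter_and (F := at_right 0) _ _
    (at_right_0_mult_le (mua * (ta - - (2 * PI / 3))) (La - - PI) ltac:(nra))
    (at_right_0_mult_le (mub * (PI / 3 - tb)) ((2 * PI - Lb) - Lb) ltac:(nra)))))))))).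
  apply filter_imp.
  intros w [[Hw W1] [[_ W2] [[_ W3] [[_ W4] [[_ W5] [[_ W6] [[_ W7] [[_ W8] [_ W9]]]]]]]]].
  intros l u phi Hl Hu Hc Hphi Hinit.
  (* As [La < - 2 PI / 3], every [x] in [[- PI, La]] has [cos x <= cos La < cos (2 PI / 3) <= cos
     t]: one rectangle below the attracting branch is enough. *)
  assert (Sa : La <= phi ta).
  { apply (josephson_climb w l u M mua phi (- (2 * PI / 3)) ta (- PI) La); auto; try lra.
    intros t x Ht Hx.
    assert (cos (- (2 * PI / 3)) <= cos t)
      by (apply cos_le_abs; rewrite !Rabs_left by lra; lra).
    assert (cos x <= cos La)
      by (apply cos_le_abs; rewrite !Rabs_left by lra; lra).
    unfold mua. lra. }
  destruct (hermite_barrier n (1 + eta) w ta tb)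
    as [B [dB [HdB [HB [[xa [Exa Bxa]] [xb [Exb Bxb]]]]]]]; try lra.
  assert (Sb : 2 * INR n * PI + Lb <= phi tb).
  { apply Rle_trans with (B tb).
    - rewrite Exb. apply Rplus_le_compat_l, Rmult_le_compat_l; [lra|].
      apply atan_le, ratio_ge_of_pos; auto. nra.
    - apply (josephson_subsolution w l u phi B dB ta tb); auto; try lra.
      + intros t Ht. apply HdB. lra.
      + intros t Ht. destruct (HB t ltac:(lra)) as [H [Z [HN E]]].
        specialize (E l u). cbv zeta in HN, E.
        apply Rminus_le_0. apply Rmult_le_reg_l with
          (((2 * cos (t / 2) * H) ^ 2 + (2 * (1 + eta) * Z) ^ 2) * w);
          [now apply Rmult_lt_0_compat|].
        rewrite Rmult_0_r, E. apply Rmult_le_pos; [lra|].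
        assert (Hct : cos t = 1 - 2 * sin (t / 2) ^ 2).
        { replace t with (2 * (t / 2)) at 1 by field. rewrite cos_2a_sin. ring. }
        rewrite Hct.
        apply (barrier_form_nonneg eta M w l u); auto; try lra.
        * apply cos_half_sqr_ge. lra.
        * rewrite <- !Rsqr_pow2. apply sin2_cos2.
      + apply Rle_trans with La; [|exact Sa]. rewrite Exa. unfold La.
        apply Rmult_le_compat_l; [lra|]. apply atan_le, ratio_le_of_neg; auto. nra. }
  (* As [Lb > PI / 3], the rectangle between [Lb] and its mirror image [2 PI - Lb] avoids the slow
     curve, and [Lb < PI] puts its top above [PI]. *)
  assert (Sc : 2 * PI - Lb <= phi (PI / 3) - 2 * INR n * PI).
  { apply (josephson_climb w l u M mub (fun t => phi t - 2 * INR n * PI)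
             tb (PI / 3) Lb); auto; try lra.
    - now apply josephson_shift.
    - intros t x Ht Hx.
      assert (cos (PI / 3) <= cos t)
        by (apply cos_le_abs; rewrite !Rabs_pos_eq by lra; lra).
      assert (cos x <= cos Lb).
      { destruct (Rle_dec x PI).
        - apply cos_le_abs; rewrite !Rabs_pos_eq by lra; lra.
        - replace (cos x) with (cos (2 * PI - x)).
          + apply cos_le_abs; rewrite !Rabs_pos_eq by lra; lra.
          + rewrite cos_minus, cos_2PI, sin_2PI. ring. }
      unfold mub. lra. }
  lra.
Qed.

(** With [rho = 1 - eta] the barrier starts above the attracting half of [phi = tau] and ends, [n]
    turns later, below the repelling half; from there the phase descends past the multiple
    [2 n PI]. *)
Lemma josephson_upper (n : nat) (eps M : R) :
  0 < eps -> at_right 0 (fun omega => forall l u phi,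
    Rabs l <= M -> Rabs u <= M -> u + l <= 2 * INR n + 1 - eps ->
    josephson_solution omega l u phi ->
    phi (- (2 * PI / 3)) <= 0 -> phi (PI / 3) < 2 * INR n * PI).
Proof.
  intros Heps. assert (HP := PI_RGT_0). assert (Hn := pos_INR n).
  pose (eta := Rmin (1 / 2) (eps / (2 * INR n + 1))).
  assert (Heta : 0 < eta <= 1 / 2).
  { split; [|apply Rmin_l]. apply Rmin_pos; [lra|]. apply Rdiv_lt_0_compat; lra. }
  assert (Heta2 : 2 * INR n + 1 - eps <= (1 - eta) * (2 * INR n + 1)).
  { assert (E := Rmin_r (1 / 2) (eps / (2 * INR n + 1))). fold eta in E.
    apply (Rmult_le_compat_r (2 * INR n + 1)) in E; [|lra].
    unfold Rdiv in E at 1. rewrite Rmult_assoc, Rinv_l in E by lra. lra. }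
  (* These times do not depend on [eta]: a flattened barrier lies strictly between [0] and
     [phi = tau] at any time. The end estimates are used on the side free of [n * omega], so no
     intermediate factor appears. *)
  pose (ta := - (PI / 3)). pose (tb := PI / 6).
  assert (Hta : - (2 * PI / 3) < ta < 0) by (unfold ta; lra).
  assert (Htb : 0 < tb < PI / 3) by (unfold tb; lra).
  destruct (half_angle_signs ta tb Hta Htb) as [HSa [HCa [HSb HCb]]].
  pose (La := 2 * atan ((1 - eta) * tan (ta / 2))).
  pose (Lb := 2 * atan ((1 - eta) * tan (tb / 2))).
  assert (HLa : ta < La < 0).
  { assert (tan (ta / 2) < 0) by (apply tan_lt_0; lra). unfold La. split.
    - assert (atan (tan (ta / 2)) < atan ((1 - eta) * tan (ta / 2)))
        by (apply atan_increasing; nra).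
      rewrite atan_tan in H0 by lra. lra.
    - assert (atan ((1 - eta) * tan (ta / 2)) < atan 0) by (apply atan_increasing; nra).
      rewrite atan_0 in H0. lra. }
  assert (HLb : 0 < Lb < tb).
  { assert (0 < tan (tb / 2)) by (apply tan_gt_0; lra). unfold Lb. split.
    - assert (atan 0 < atan ((1 - eta) * tan (tb / 2))) by (apply atan_increasing; nra).
      rewrite atan_0 in H0. lra.
    - assert (atan ((1 - eta) * tan (tb / 2)) < atan (tan (tb / 2)))
        by (apply atan_increasing; nra).
      rewrite atan_tan in H0 by lra. lra. }
  pose (mua := (cos La - cos ta) / 2). pose (mub := (cos Lb - cos tb) / 2).
  assert (Hmua : 0 < mua).
  { assert (cos ta < cos La); [|unfold mua; lra].
    apply cos_lt_abs. rewrite !Rabs_left by lra. lra. }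
  assert (Hmub : 0 < mub).
  { assert (cos tb < cos Lb); [|unfold mub; lra].
    apply cos_lt_abs. rewrite !Rabs_pos_eq by lra. lra. }
  assert (HSa2 : 0 < sin (ta / 2) ^ 2) by nra.
  assert (HSb2 : 0 < sin (tb / 2) ^ 2) by nra.
  generalize (filter_and (F := at_right 0) _ _
    (at_right_0_mult_le (sin (ta / 2) ^ 2) (INR n) HSa2) (filter_and (F := at_right 0) _ _
    (at_right_0_mult_le (sin (tb / 2) ^ 2) (INR n) HSb2) (filter_and (F := at_right 0) _ _
    (at_right_0_mult_le (eta / 4) (8 * M + 1) ltac:(lra)) (filter_and (F := at_right 0) _ _
    (at_right_0_mult_le mua (2 * M) Hmua) (filter_and (F := at_right 0) _ _
    (at_right_0_mult_le mub (2 * M) Hmub) (filter_and (F := at_right 0) _ _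
    (at_right_0_mult_le (mua * (ta - - (2 * PI / 3))) (0 - La) ltac:(nra))
    (at_right_0_mult_le (mub * (PI / 3 - tb)) (Lb - - Lb) ltac:(nra)))))))).
  apply filter_imp.
  intros w [[Hw W1] [[_ W2] [[_ W3] [[_ W4] [[_ W5] [[_ W6] [_ W7]]]]]]].
  intros l u phi Hl Hu Hc Hphi Hinit.
  assert (Sa : phi ta <= La).
  { apply (josephson_descend w l u M mua phi (- (2 * PI / 3)) ta 0 La); auto; try lra.
    intros t x Ht Hx.
    assert (cos t <= cos ta)
      by (apply cos_le_abs; rewrite !Rabs_left by lra; lra).
    assert (cos La <= cos x)
      by (apply cos_le_abs; rewrite !Rabs_left1 by lra; lra).
    unfold mua. lra. }
  destruct (hermite_barrier n (1 - eta) w ta tb)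
    as [B [dB [HdB [HB [[xa [Exa Bxa]] [xb [Exb Bxb]]]]]]]; try lra.
  assert (Sb : phi tb <= 2 * INR n * PI + Lb).
  { apply Rle_trans with (B tb).
    2: { rewrite Exb. apply Rplus_le_compat_l, Rmult_le_compat_l; [lra|].
      apply atan_le, ratio_le_of_pos; auto. lra. }
    apply (josephson_supersolution w l u phi B dB ta tb); auto; try lra.
    - intros t Ht. apply HdB. lra.
    - intros t Ht. destruct (HB t ltac:(lra)) as [H [Z [HN E]]].
      specialize (E l u). cbv zeta in HN, E.
      apply Rminus_le. apply Rmult_le_reg_l with
        (((2 * cos (t / 2) * H) ^ 2 + (2 * (1 - eta) * Z) ^ 2) * w);
        [now apply Rmult_lt_0_compat|].
      rewrite Rmult_0_r, E.
      assert (Hct : cos t = 1 - 2 * sin (t / 2) ^ 2).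
      { replace t with (2 * (t / 2)) at 1 by field. rewrite cos_2a_sin. ring. }
      rewrite Hct.
      assert (F := barrier_form_nonpos eta M w l u (2 * INR n + 1) (sin (t / 2)) (cos (t / 2)) H Z).
      cbv zeta in F.
      assert (H4 : forall z, z <= 0 -> 4 * z <= 0) by (intros; lra).
      apply H4, F; auto; try lra.
      + apply cos_half_sqr_ge. lra.
      + rewrite <- !Rsqr_pow2. apply sin2_cos2.
    - apply Rle_trans with La; [exact Sa|]. rewrite Exa. unfold La.
      apply Rmult_le_compat_l; [lra|]. apply atan_le, ratio_ge_of_neg; auto. lra. }
  assert (Sc : phi (PI / 3) - 2 * INR n * PI <= - Lb).
  { apply (josephson_descend w l u M mub (fun t => phi t - 2 * INR n * PI)
             tb (PI / 3) Lb); auto; try lra.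
    - now apply josephson_shift.
    - intros t x Ht Hx.
      assert (cos t <= cos tb)
        by (apply cos_le_abs; rewrite !Rabs_pos_eq by lra; lra).
      assert (cos Lb <= cos x).
      { apply cos_le_abs. rewrite (Rabs_pos_eq Lb) by lra. split; [apply Rabs_le|]; lra. }
      unfold mub. lra. }
  lra.
Qed.

(** The lower bound for zero turns, where [u + l] may be very negative and no Hermite barrier lies
    below. Near [- PI] the leading term is positive during the whole segment, so the phase climbs
    away from [- PI]. *)
Lemma josephson_no_descent (M : R) :
  at_right 0 (fun omega => forall l u phi,
    Rabs l <= M -> Rabs u <= M -> josephson_solution omega l u phi ->
    - PI <= phi (- (2 * PI / 3)) -> - PI < phi (PI / 3)).
Proof.
  assert (HP := PI_RGT_0).
  pose (mu := (cos (2 * PI / 3) - cos (5 * PI / 6)) / 2).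
  assert (Hmu : 0 < mu).
  { assert (cos (5 * PI / 6) < cos (2 * PI / 3)); [|unfold mu; lra].
    apply cos_lt_abs. rewrite !Rabs_pos_eq by lra. lra. }
  generalize (filter_and (F := at_right 0) _ _
    (at_right_0_mult_le mu (2 * M) Hmu)
    (at_right_0_mult_le (mu * (PI / 3 - - (2 * PI / 3))) (- (5 * PI / 6) - - PI)
       ltac:(nra))).
  apply filter_imp. intros w [[Hw W1] [_ W2]] l u phi Hl Hu Hphi Hinit.
  assert (- (5 * PI / 6) <= phi (PI / 3)); [|lra].
  apply (josephson_climb w l u M mu phi (- (2 * PI / 3)) (PI / 3) (- PI)); auto; try lra.
  intros t x Ht Hx.
  assert (cos (2 * PI / 3) <= cos t).
  { apply cos_le_abs. rewrite (Rabs_pos_eq (2 * PI / 3)) by lra.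
    split; [apply Rabs_le|]; lra. }
  assert (cos x <= cos (5 * PI / 6)).
  { apply cos_le_abs. rewrite (Rabs_pos_eq (5 * PI / 6)), Rabs_left by lra. lra. }
  unfold mu. lra.
Qed.

(** For [m = n + 1] the interval for [u + l] lies above [2n+1] and below [2(n+1)+1]: the lower bound
    is taken at index [n], the upper one at [n + 1], and they differ by exactly one half-turn, the
    length of the target segment. *)
Lemma josephson_transition (m : nat) (eps M : R) :
  0 < eps < 1 -> at_right 0 (fun omega => forall l u phi,
    Rabs l <= M -> Rabs u <= M -> Z_interval m eps (u + l) ->
    josephson_solution omega l u phi ->
    - PI <= phi (- (2 * PI / 3)) <= 0 ->
    2 * PI * INR m - PI < phi (PI / 3) < 2 * PI * INR m).
Proof.
  intros Heps. destruct m as [|n].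
  - generalize (filter_and (F := at_right 0) _ _
      (josephson_no_descent M) (josephson_upper 0 eps M (proj1 Heps))).
    apply filter_imp. intros w [W1 W2] l u phi Hl Hu [_ HZ] Hphi Hinit.
    assert (A := W1 l u phi Hl Hu Hphi (proj1 Hinit)).
    assert (B := W2 l u phi Hl Hu ltac:(simpl; lra) Hphi (proj2 Hinit)).
    simpl in *. lra.
  - generalize (filter_and (F := at_right 0) _ _
      (josephson_lower n eps M (proj1 Heps)) (josephson_upper (S n) eps M (proj1 Heps))).
    apply filter_imp. intros w [W1 W2] l u phi Hl Hu [HZ1 HZ2] Hphi Hinit.
    assert (A := W1 l u phi Hl Hu ltac:(rewrite S_INR in HZ1; lra) Hphi (proj1 Hinit)).
    assert (B := W2 l u phi Hl Hu ltac:(lra) Hphi (proj2 Hinit)).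
    rewrite S_INR in *. lra.
Qed.

(** * Bounds on the parameters and return to the flow *)

Lemma Z_interval_bound (m : nat) (eps x : R) :
  0 < eps < 1 -> Z_interval m eps x -> Rabs x <= 1 / eps + 2 * INR m + 1.
Proof.
  intros Heps HZ.
  assert (0 < 1 / eps) by (apply Rdiv_lt_0_compat; lra).
  destruct m as [|n]; simpl in HZ.
  - simpl. apply Rabs_le. lra.
  - change (match n with O => 1 | S _ => INR n + 1 end) with (INR (S n)) in HZ.
    assert (Hn := pos_INR n). rewrite S_INR in *. apply Rabs_le. lra.
Qed.

Lemma hinterior_intro (J : hsegment) (p : R * R) :
  seg_left J < fst p < seg_right J -> snd p = seg_height J -> hinterior J p.
Proof.
  intros Hp Hh. unfold hinterior, seg_set. simpl.
  apply (filter_imp (fun x : R => seg_left J < x /\ x < seg_right J)).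
  - intros x Hx. split; [lra|exact Hh].
  - apply (open_and (fun x => seg_left J < x) (fun x => x < seg_right J));
      [apply open_gt|apply open_lt|exact Hp].
Qed.

Lemma josephson_of_flow (omega l u tau0 : R) (x : R -> R) :
  0 < omega ->
  (forall t, is_derive x t
     (cos (x t) + l * omega + (1 + u * omega) * cos (tau0 + omega * t))) ->
  josephson_solution omega l u (fun tau => x ((tau - tau0) / omega) - PI).
Proof.
  intros Hw Hx. refine (fun tau : R => _).
  assert (Hd : is_derive (fun tau => (tau - tau0) / omega) tau (/ omega))
    by (auto_derive; [trivial|apply Rmult_1_l]).
  evar_last.
  - apply (is_derive_minus (fun tau => x ((tau - tau0) / omega)) (fun _ => PI)).
    + apply (is_derive_comp x (fun tau => (tau - tau0) / omega)); [apply Hx|exact Hd].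
    + apply is_derive_const.
  - unfold josephson, minus, plus, opp, zero, scal; simpl. unfold mult; simpl.
    rewrite cos_minus, cos_PI, sin_PI.
    replace (tau0 + omega * ((tau - tau0) / omega)) with tau by (field; lra).
    field. lra.
Qed.

(* The symmetry [(theta, tau) -> (2 pi m + pi - theta, tau - pi)] changes the
   sign of [l], hence exchanges [c_+] and [c_-]. *)
Lemma josephson_of_flow_reversed (omega l u : R) (m : nat) (x : R -> R) :
  0 < omega ->
  (forall t, is_derive x t
     (cos (x t) + l * omega + (1 + u * omega) * cos (PI / 3 + omega * t))) ->
  josephson_solution omega (- l) u
    (fun tau => 2 * INR m * PI - x ((tau + 2 * PI / 3) / omega)).
Proof.
  intros Hw Hx. refine (fun tau : R => _).
  assert (Hd : is_derive (fun tau => (tau + 2 * PI / 3) / omega) tau (/ omega))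
    by (auto_derive; [trivial|apply Rmult_1_l]).
  evar_last.
  - apply (is_derive_minus (fun _ => 2 * INR m * PI)
             (fun tau => x ((tau + 2 * PI / 3) / omega))).
    + apply is_derive_const.
    + apply (is_derive_comp x (fun tau => (tau + 2 * PI / 3) / omega)); [apply Hx|exact Hd].
  - unfold josephson, minus, plus, opp, zero, scal; simpl. unfold mult; simpl.
    set (X := x ((tau + 2 * PI / 3) / omega)).
    replace (PI / 3 + omega * ((tau + 2 * PI / 3) / omega)) with (tau + PI)
      by (field; lra).
    rewrite neg_cos.
    replace (cos (2 * INR m * PI - X)) with (cos X).
    + field. lra.
    + replace (2 * INR m * PI - X) with (- X + 2 * INR m * PI) by ring.
      now rewrite cos_period, cos_neg.
Qed.

Theorem theorem1p14 :
  forall (m k : nat) (eps : R), 0 < eps < 1 ->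
  exists omega0 : R, 0 < omega0 /\
  forall omega : R, 0 < omega < omega0 ->
  forall l u : R,
    let c_plus := u + l in
    let c_minus := u - l in
    Z_interval m eps c_plus ->
    Z_interval k eps c_minus ->
    orbit_enters_interior omega l u I0 (I1' m) /\
    orbit_enters_interior omega l u (I1' m) (I0' m k).
Proof.
  intros m k eps Heps. assert (HP := PI_RGT_0).
  (* [u] and [l] are the half-sum and half-difference of [c_plus] and [c_minus], so the sum of the
     two bounds dominates both. *)
  pose (M := (1 / eps + 2 * INR m + 1) + (1 / eps + 2 * INR k + 1)).
  destruct (filter_and (F := at_right 0) _ _
    (josephson_transition m eps M Heps) (josephson_transition k eps M Heps))
    as [omega0 H0].
  exists omega0. split; [apply cond_pos|].
  intros omega Hw l u c_plus c_minus HZm HZk.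
  destruct (H0 omega) as [Hm Hk].
  { change (Rabs (omega - 0) < omega0). rewrite Rminus_0_r, Rabs_pos_eq; lra. }
  { lra. }
  assert (Bm := Z_interval_bound m eps _ Heps HZm).
  assert (Bk := Z_interval_bound k eps _ Heps HZk).
  apply Rabs_le_between in Bm, Bk. unfold c_plus, c_minus in *.
  assert (Hl : Rabs l <= M) by (unfold M; apply Rabs_le; lra).
  assert (Hu : Rabs u <= M) by (unfold M; apply Rabs_le; lra).
  split; intros p [Hp1 Hp2].
  - destruct (flow_spec omega l u p) as [x [Hx0 [Hx Hflow]]].
    simpl in Hp1, Hp2. rewrite Hflow.
    rewrite Hp2 in Hx. apply josephson_of_flow in Hx; [|lra].
    destruct (Hm l u _ Hl Hu HZm Hx) as [Hlo Hhi].
    { replace ((- (2 * PI / 3) - - (2 * PI / 3)) / omega) with 0 by (field; lra). lra. }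
    replace (PI / 3 - - (2 * PI / 3)) with (PI / 3 + 0 - - (2 * PI / 3)) in Hlo, Hhi by ring.
    apply hinterior_intro; simpl; [lra|]. rewrite Hp2. field. lra.
  - destruct (flow_spec omega l u p) as [x [Hx0 [Hx Hflow]]].
    simpl in Hp1, Hp2. rewrite Rplus_0_r in Hp2. rewrite Hflow.
    rewrite Hp2 in Hx. apply (josephson_of_flow_reversed omega l u m) in Hx; [|lra].
    (* The reversed phase solves the equation with [- l], and [u - l] unfolds to [u + - l], so [HZk]
       is the required hypothesis. The interval around [2 PI k] obtained for [2 PI m - theta]
       becomes the translate by [2 PI (m - k)]. *)
    destruct (Hk (- l) u _ ltac:(now rewrite Rabs_Ropp) Hu HZk Hx) as [Hlo Hhi].
    { replace ((- (2 * PI / 3) + 2 * PI / 3) / omega) with 0 by (field; lra). lra. }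
    replace (PI / 3 + 2 * PI / 3) with (- (2 * PI / 3) + 2 * PI - (PI / 3 + 0))
      in Hlo, Hhi by field.
    apply hinterior_intro; simpl; [lra|]. rewrite Hp2. field. lra.
Qed.
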